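(* Let $c,h,a,b,c_1,h_1,a_1,b_1\in\mathbb{C}$ with $0\le\mathrm{Re}(a)<1$, $0\le\mathrm{Re}(a_1)<1$, $b\ne1$ and $b_1\neq1$. Then $V(c,h)\otimes SA'_{a,b}\cong V(c_1,h_1)\otimes SA'_{a_1,b_1}$ as modules over the Neveu-Schwarz algebra $\mathfrak{NS}$ if and only if $c=c_1$, $h=h_1$, $a=a_1$ and $b=b_1$.
   Context: The ground field is $\mathbb{C}$. The Neveu-Schwarz algebra $\mathfrak{NS}$ is the Lie superalgebra with even part having basis $\{L_n, C : n\in\mathbb{Z}\}$ and odd part having basis $\{G_r : r\in\frac12+\mathbb{Z}\}$, with brackets $[L_m,L_n]=(n-m)L_{m+n}+\delta_{m+n,0}\frac{m^3-m}{12}C$, $[L_m,G_r]=(r-\frac m2)G_{m+r}$, $[G_r,G_s]=2L_{r+s}-\frac13\delta_{r+s,0}(r^2-\frac14)C$, and $C$ central. Let $\mathfrak{n}^+$ be the span of all $L_i$ ($i\in\mathbb{Z}$, $i>0$) and $G_r$ ($r\in\frac12+\mathbb{Z}$, $r>0$), and $\mathfrak{b}^+=\mathfrak{n}^+\oplus\mathbb{C}L_0\oplus\mathbb{C}C$. $V(c,h)$ is the unique simple quotient of the Verma module $M(c,h)=U(\mathfrak{NS})\otimes_{U(\mathfrak{b}^+)}\mathbb{C}u$, where $u$ is even, $\mathfrak{n}^+u=0$, $L_0u=hu$, $Cu=cu$. For $a,b\in\mathbb{C}$, $SA_{a,b}$ is the $\mathfrak{NS}$-module with even basis $\{x_i: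 i\in\mathbb{Z}\}$, odd basis $\{y_{\frac12+i}: i\in\mathbb{Z}\}$ and action (for $i,j\in\mathbb{Z}$) $L_ix_j=(a+j+ib)x_{i+j}$, $L_iy_{\frac12+j}=(a+\frac12+j+i(b-\frac12))y_{\frac12+i+j}$, $G_{\frac12+i}x_j=y_{\frac12+i+j}$, $G_{\frac12+i}y_{\frac12+j}=(a+\frac12+j+2(\frac12+i)(b-\frac12))x_{1+i+j}$, and $C$ acts by $0$. For $0\le\mathrm{Re}(a)<1$ and $b\ne1$, put $SA'_{\frac12,\frac12}=SA_{\frac12,\frac12}/\mathbb{C}y_{-\frac12}$ and $SA'_{a,b}=SA_{a,b}$ if $(a,b)\neq(\frac12,\frac12)$; these modules are irreducible. Tensor products carry the super action $g(v\otimes w)=gv\otimes w+(-1)^{|g||v|}v\otimes gw$ for homogeneous $g,v$. An isomorphism of $\mathfrak{NS}$-modules is a linear bijection commuting with the action of every element of $\mathfrak{NS}$. *)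

(* Defs.v *)
From HB Require Import structures.
From mathcomp Require Import all_boot all_order all_algebra generic_quotient.
From mathcomp Require Import boolp classical_sets reals.
From mathcomp Require Import complex finmap ring.
From mathcomp.multinomials Require Import monalg.

Set Implicit Arguments.
Unset Strict Implicit.
Unset Printing Implicit Defensive.

Import Order.TTheory GRing.Theory Num.Theory.
Local Open Scope ring_scope.
Local Open Scope quotient_scope.

(* The constructions below are sealed with this key (see [locked_with]), to keep
   unification from unfolding them. *)
Fact seal_key : unit. Proof. exact: tt. Qed.

Section Span.
Variables (K : pzRingType) (V : lmodType K) (S : set V).

Definition span_pred : {pred V} :=
  fun x => `[< forall N : submodClosed V, (forall y, S y -> y \in N) -> x \in N >].

Lemma span_subproof : subsemimod_closed span_pred.
Proof.
split; first by split=> [|x y /asboolP xS /asboolP yS]; apply/asboolP => N SN;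
  rewrite ?rpred0 ?rpredD ?xS ?yS.
by move=> a x /asboolP xS; apply/asboolP => N SN; rewrite rpredZ ?xS.
Qed.

HB.instance Definition _ := GRing.isSubmodClosed.Build K V span_pred span_subproof.

Definition span : submodClosed V := span_pred.

Lemma mem_span x : S x -> x \in span.
Proof. by move=> Sx; apply/asboolP => N; apply. Qed.

Lemma span_min (N : submodClosed V) :
  (forall y, S y -> y \in N) -> forall x, x \in span -> x \in N.
Proof. by move=> SN x /asboolP; apply. Qed.

End Span.

Section Quotient.
Variables (K : pzRingType) (V : lmodType K) (N : submodClosed V).

Definition qequiv (x y : V) := (x - y) \in N.

Lemma qequivN x : (- x \in N) = (x \in N).
Proof.
by apply/idP/idP => /(rpredZ (-1)); rewrite scaleN1r ?opprK.
Qed.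

Lemma qequiv_is_equiv : equiv_class_of qequiv.
Proof.
split=> [x|x y|y x z]; rewrite /qequiv ?subrr ?rpred0 //.
  by rewrite -opprB qequivN.
by move=> xy yz; rewrite -[x](addrNK y) -addrA rpredD.
Qed.

Canonical qequiv_equiv := EquivRelPack qequiv_is_equiv.
Canonical qequiv_encModRel := defaultEncModRel qequiv.

Definition quotm := {eq_quot qequiv}.

HB.instance Definition _ : EqQuotient V qequiv quotm := EqQuotient.on quotm.
HB.instance Definition _ := Choice.on quotm.

Definition qpi : V -> quotm := locked_with seal_key (fun x => \pi x).

Lemma qpiP x y : (qpi x = qpi y) <-> (x - y \in N).
Proof. by rewrite /qpi locked_withE; split=> [/eqP|xy]; [|apply/eqP]; rewrite piE. Qed.

Lemma qpi_repr (x : quotm) : qpi (repr x) = x.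
Proof. by rewrite /qpi locked_withE reprK. Qed.

Lemma repr_qpi x : repr (qpi x) - x \in N.
Proof. by apply/qpiP; rewrite qpi_repr. Qed.

Definition qadd : quotm -> quotm -> quotm :=
  locked_with seal_key (fun x y => qpi (repr x + repr y)).
Definition qopp : quotm -> quotm :=
  locked_with seal_key (fun x => qpi (- repr x)).
Definition qscale : K -> quotm -> quotm :=
  locked_with seal_key (fun a x => qpi (a *: repr x)).

Lemma qpi_add x y : qadd (qpi x) (qpi y) = qpi (x + y).
Proof. by rewrite /qadd locked_withE; apply/qpiP; rewrite opprD addrACA rpredD ?repr_qpi. Qed.

Lemma qpi_opp x : qopp (qpi x) = qpi (- x).
Proof. by rewrite /qopp locked_withE; apply/qpiP; rewrite -opprD qequivN repr_qpi. Qed.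

Lemma qpi_scale a x : qscale a (qpi x) = qpi (a *: x).
Proof. by rewrite /qscale locked_withE; apply/qpiP; rewrite -scalerBr rpredZ ?repr_qpi. Qed.

Lemma qind (P : quotm -> Prop) : (forall x, P (qpi x)) -> forall x, P x.
Proof. by move=> Pq x; rewrite -[x]qpi_repr. Qed.

Lemma qaddA : associative qadd.
Proof. by elim/qind=> x; elim/qind=> y; elim/qind=> z; rewrite !qpi_add addrA. Qed.

Lemma qaddC : commutative qadd.
Proof. by elim/qind=> x; elim/qind=> y; rewrite !qpi_add addrC. Qed.

Lemma qadd0 : left_id (qpi 0) qadd.
Proof. by elim/qind=> x; rewrite qpi_add add0r. Qed.

Lemma qaddN : left_inverse (qpi 0) qopp qadd.
Proof. by elim/qind=> x; rewrite qpi_opp qpi_add addNr. Qed.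

HB.instance Definition _ := GRing.isZmodule.Build quotm qaddA qaddC qadd0 qaddN.

Lemma qscaleA a b x : qscale a (qscale b x) = qscale (a * b) x.
Proof. by elim/qind: x => x; rewrite !qpi_scale scalerA. Qed.

Lemma qscale1 : left_id 1 qscale.
Proof. by elim/qind=> x; rewrite !qpi_scale scale1r. Qed.

Lemma qscaleDr : right_distributive qscale +%R.
Proof.
move=> a; elim/qind=> x; elim/qind=> y.
have qD u v : qpi u + qpi v = qpi (u + v) by exact: qpi_add.
by rewrite qD !qpi_scale qD scalerDr.
Qed.

Lemma qscaleDl x : {morph qscale^~ x : a b / a + b}.
Proof.
by move=> a b; elim/qind: x => x; rewrite !qpi_scale scalerDl -qpi_add.
Qed.

HB.instance Definition _ := GRing.Zmodule_isLmodule.Build K quotm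
  qscaleA qscale1 qscaleDr qscaleDl.

Lemma qpi_is_linear : linear qpi.
Proof. by move=> a x y; rewrite -qpi_add -qpi_scale. Qed.

HB.instance Definition _ := GRing.isLinear.Build K V quotm *:%R qpi qpi_is_linear.

Lemma qpi_eq0 x : (qpi x == 0) = (x \in N).
Proof. by apply/eqP/idP => [/qpiP|xN]; [|apply/qpiP]; rewrite subr0. Qed.

Section Lift.
Variables (W : lmodType K) (f : {linear V -> W}).
Hypothesis fN : forall x, x \in N -> f x = 0.

Definition qlift_fun : quotm -> W := locked_with seal_key (fun x => f (repr x)).

Lemma qlift_funE x : qlift_fun (qpi x) = f x.
Proof. by rewrite /qlift_fun locked_withE; apply/eqP; rewrite -subr_eq0 -linearB fN ?repr_qpi. Qed.

Lemma qlift_is_linear : linear qlift_fun.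
Proof.
move=> a; elim/qind=> x; elim/qind=> y.
by rewrite -linearZ -linearD !qlift_funE linearP.
Qed.

HB.instance Definition _ := GRing.isLinear.Build K quotm W *:%R qlift_fun
  qlift_is_linear.

Definition qlift : {linear quotm -> W} := qlift_fun.

Lemma qliftE x : qlift (qpi x) = f x. Proof. exact: qlift_funE. Qed.

End Lift.

End Quotient.

Section SpanLinear.
Variables (K : pzRingType) (V W : lmodType K) (f : V -> W) (fl : linear f).

Let f' : {linear V -> W} := HB.pack f (GRing.isLinear.Build K V W *:%R f fl).

Lemma span_linear (S : set V) (N : submodClosed W) :
  (forall y, S y -> f y \in N) -> forall x, x \in span S -> f x \in N.
Proof.
pose M : {pred V} := fun x => f' x \in N.
have MP : subsemimod_closed M.
  split; first split.
  - by rewrite unfold_in /M linear0 rpred0.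
  - by move=> x y xN yN; rewrite unfold_in /M linearD rpredD.
  - by move=> a x xN; rewrite unfold_in /M linearZ rpredZ.
pose M' : submodClosed V := HB.pack M (GRing.isSubmodClosed.Build K V M MP).
by move=> SN x; apply: (span_min (N := M')).
Qed.

Lemma span_eq0 (S : set V) :
  (forall y, S y -> f y = 0) -> forall x, x \in span S -> f x = 0.
Proof.
pose M : {pred V} := fun x => f' x == 0.
have MP : subsemimod_closed M.
  split; first split; rewrite /M ?unfold_in ?linear0 //.
    by move=> x y; rewrite !unfold_in linearD => /eqP-> /eqP->; rewrite addr0.
  by move=> a x; rewrite !unfold_in linearZ /= => /eqP->; rewrite scaler0.
pose M' : submodClosed V := HB.pack M (GRing.isSubmodClosed.Build K V M MP).
by move=> SN x xS; apply/eqP; apply: (span_min (N := M') _ xS) => y /SN/eqP.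
Qed.

End SpanLinear.

Section Free.
Variables (K : nzRingType) (B : choiceType).

Definition bas : B -> {malg K[B]} := locked_with seal_key (fun k => << k >>).

Lemma basE k : bas k = << k >>. Proof. by rewrite /bas locked_withE. Qed.

Lemma mcoeff_bas k l : (bas k)@_l = (k == l)%:R.
Proof. by rewrite basE mcoeffU. Qed.

Section Ext.
Variables (W : lmodType K) (f : B -> W).

Definition linext_fun : {malg K[B]} -> W :=
  locked_with seal_key (fun m => \sum_(k <- msupp m) m@_k *: f k).

Lemma linext_funE m : linext_fun m = \sum_(k <- msupp m) m@_k *: f k.
Proof. by rewrite /linext_fun locked_withE. Qed.

Lemma linext_funEw (d : {fset B}) m : (msupp m `<=` d)%fset ->
  linext_fun m = \sum_(k <- d) m@_k *: f k.
Proof.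
move=> le; rewrite linext_funE (big_fset_incl _ le) => //= x xd /mcoeff_outdom ->.
by rewrite scale0r.
Qed.

Lemma linext_is_linear : linear linext_fun.
Proof.
move=> a u v; pose d := (msupp u `|` msupp v)%fset.
have ud : (msupp u `<=` d)%fset by exact: fsubsetUl.
have vd : (msupp v `<=` d)%fset by exact: fsubsetUr.
have uvd : (msupp (a *: u + v) `<=` d)%fset.
  apply: fsubset_trans (msuppD_le _ _) _; apply: fsetSU; exact: msuppZ_le.
rewrite !(@linext_funEw d) // scaler_sumr -big_split /=.
by apply: eq_bigr => k _; rewrite mcoeffD mcoeffZ scalerDl scalerA.
Qed.

HB.instance Definition _ := GRing.isLinear.Build K {malg K[B]} W *:%R linext_fun
  linext_is_linear.

Definition linext : {linear {malg K[B]} -> W} := linext_fun.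

Lemma linextE k : linext (bas k) = f k.
Proof.
by rewrite basE /= (linext_funEw msuppU_le) big_seq_fset1 mcoeffUU scale1r.
Qed.

End Ext.

Lemma malg_scaleU (m : {malg K[B]}) : m = \sum_(k <- msupp m) m@_k *: bas k.
Proof.
rewrite [LHS]monalgE; apply: eq_bigr => k _; apply/malgP => l.
by rewrite mcoeffZ mcoeff_bas mcoeffU mulr_natr.
Qed.

Lemma linear_bas (W : lmodType K) (f g : {malg K[B]} -> W) :
  linear f -> linear g -> (forall k, f (bas k) = g (bas k)) -> f =1 g.
Proof.
move=> fl gl fg m.
pose F : {linear {malg K[B]} -> W} := HB.pack f (GRing.isLinear.Build K _ W *:%R f fl).
pose G : {linear {malg K[B]} -> W} := HB.pack g (GRing.isLinear.Build K _ W *:%R g gl).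
rewrite (malg_scaleU m) -[f]/(F : _ -> _) -[g]/(G : _ -> _) !linear_sum.
by apply: eq_bigr => k _; rewrite !linearZ /= fg.
Qed.

End Free.

Lemma basM (K : nzRingType) (B : monomType) (k l : B) :
  bas K k * bas K l = bas K (mmul k l).
Proof.
rewrite !basE (malgMEw msuppU_le msuppU_le).
by rewrite !big_seq_fset1 !mcoeffUU mulr1.
Qed.

Section Tensor.
Variables (K : comNzRingType) (V W : lmodType K).

Inductive tensor_rel : set {malg K[(V * W)%type]} :=
| TensorRelL a v v' w :
    tensor_rel (bas K (a *: v + v', w) - (a *: bas K (v, w) + bas K (v', w)))
| TensorRelR a v w w' :
    tensor_rel (bas K (v, a *: w + w') - (a *: bas K (v, w) + bas K (v, w'))).

Definition tensor := quotm (span tensor_rel).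
HB.instance Definition _ := GRing.Lmodule.on tensor.

Definition tens (v : V) (w : W) : tensor := qpi _ (bas K (v, w)).

Lemma tens_linearl w : linear (tens^~ w).
Proof.
move=> a v v'; rewrite /tens -linearP; apply/qpiP/mem_span; exact: TensorRelL.
Qed.

Lemma tens_linearr v : linear (tens v).
Proof.
move=> a w w'; rewrite /tens -linearP; apply/qpiP/mem_span; exact: TensorRelR.
Qed.

Section TensorLift.
Variables (X : lmodType K) (f : V -> W -> X).
Hypothesis fl : forall w, linear (f^~ w).
Hypothesis fr : forall v, linear (f v).

Lemma tlift_subproof x :
  x \in span tensor_rel -> linext (fun p : V * W => f p.1 p.2) x = 0.
Proof.
apply: (span_eq0 (linearP _)) => _ [a v v' w|a v w w'];
  by rewrite linearB linearP !linextE /= ?fl ?fr subrr.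
Qed.

Definition tlift : {linear tensor -> X} := qlift tlift_subproof.

Lemma tliftE v w : tlift (tens v w) = f v w.
Proof. by rewrite /tlift /tens qliftE linextE. Qed.

End TensorLift.

Lemma linear_tens (X : lmodType K) (f g : tensor -> X) :
  linear f -> linear g -> (forall v w, f (tens v w) = g (tens v w)) -> f =1 g.
Proof.
move=> fl gl fg; elim/qind => x.
move: x; apply: (linear_bas (f := f \o qpi _) (g := g \o qpi _)) => [a x y|a x y|[v w]].
- by rewrite /= linearP fl.
- by rewrite /= linearP gl.
- exact: fg.
Qed.

End Tensor.

(* [genG k] stands for the odd element G_{k+1/2} *)
Inductive nsgen := genL of int | genG of int | genC.

Definition nsgen_code (g : nsgen) : int + int + unit :=
  match g with genL n => inl (inl n) | genG k => inl (inr k) | genC => inr tt end.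

Definition nsgen_decode (x : int + int + unit) : nsgen :=
  match x with inl (inl n) => genL n | inl (inr k) => genG k | inr _ => genC end.

Lemma nsgen_codeK : cancel nsgen_code nsgen_decode. Proof. by case. Qed.

HB.instance Definition _ := Countable.copy nsgen (can_type nsgen_codeK).

Definition isodd (g : nsgen) : bool := if g is genG _ then true else false.

Section NS.
Variable K : numFieldType.

Local Notation NS := {malg K[nsgen]}.

Definition nsb (g : nsgen) : NS := bas K g.

Definition half (k : int) : K := k%:~R + 2^-1.

Definition nsbr (g g' : nsgen) : NS :=
  match g, g' with
  | genL m, genL n =>
      (n - m)%:~R *: nsb (genL (m + n)) +
      ((m + n == 0)%:R * ((m ^+ 3 - m)%:~R / 12)) *: nsb genC
  | genL m, genG k => (half k - m%:~R / 2) *: nsb (genG (m + k))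
  | genG k, genL m => - (half k - m%:~R / 2) *: nsb (genG (m + k))
  | genG k, genG l =>
      2 *: nsb (genL (k + l + 1)) -
      (3^-1 * (k + l + 1 == 0)%:R * (half k ^+ 2 - 4^-1)) *: nsb genC
  | _, _ => 0
  end.

(* A module is a Z/2-graded space, the grading being recorded by its parity
   operator (+1 on even vectors, -1 on odd vectors), on which the basis of NS
   acts; [nsact] below is the action of an arbitrary element of NS. *)
Record nsmod := NsMod {
  nscar :> lmodType K;
  nspar : {linear nscar -> nscar};
  nsgact : nsgen -> {linear nscar -> nscar};
  nsparK : involutive nspar;
  nspar_gact : forall g v, nspar (nsgact g v) = (-1) ^+ isodd g *: nsgact g (nspar v);
  nsgact_br : forall g g' v,
    nsgact g (nsgact g' v) - (-1) ^+ (isodd g && isodd g') *: nsgact g' (nsgact g v) =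
    linext (fun k => nsgact k v) (nsbr g g')
}.

Arguments nspar {n}.
Arguments nsgact {n} g.

Definition nsact (M : nsmod) (x : NS) (v : M) : M := linext (fun g => nsgact g v) x.

Lemma nsact_nsb (M : nsmod) g (v : M) : nsact (nsb g) v = nsgact g v.
Proof. exact: linextE. Qed.

Definition nsiso (M M' : nsmod) : Prop :=
  exists f : {linear M -> M'},
    bijective f /\ forall x v, f (nsact x v) = nsact x (f v).

(* Submodules are graded. For the Verma modules this is no restriction, as the
   parity of a weight vector is determined by its L_0-weight. *)
Definition is_submod (M : nsmod) (N : submodClosed M) : Prop :=
  (forall v, v \in N -> nspar v \in N) /\
  (forall x v, v \in N -> nsact x v \in N).

Definition is_simple (M : nsmod) : Prop :=
  (exists v : M, v != 0) /\
  forall N : submodClosed M, is_submod N ->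
    (forall v, v \in N -> v = 0) \/ (forall v, v \in N).

Lemma linear_linext (V W : lmodType K) (f : V -> W) (F : nsgen -> V) x :
  linear f -> f (linext F x) = linext (f \o F) x.
Proof.
move=> fl; move: x; apply: (linear_bas (f := f \o linext F)) => [a x y||k].
- by rewrite /= linearP fl.
- exact: linearP.
- by rewrite [LHS]/comp !linextE.
Qed.

Lemma eq_linext (V : lmodType K) (F G : nsgen -> V) : F =1 G -> linext F =1 linext G.
Proof.
by move=> FG; apply: linear_bas => [||k]; rewrite ?linextE ?FG //; exact: linearP.
Qed.

Lemma linext_nsbr (V : lmodType K) (F G : nsgen -> V) g g' :
  (forall k, isodd k = isodd g (+) isodd g' -> F k = G k) ->
  linext F (nsbr g g') = linext G (nsbr g g').
Proof.
by case: g g' => [m|i|] [n|j|] /= FG; rewrite ?linear0 // ?linearB ?linearD !linearZ !linextE /= !FG.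
Qed.

Section LinextBr.
Variables (V : lmodType K) (F : nsgen -> V).

Let linext1 k g : linext F (k *: nsb g) = k *: F g.
Proof. by rewrite linearZ /= linextE. Qed.

Let linext2 k l g g' : linext F (k *: nsb g + l *: nsb g') = k *: F g + l *: F g'.
Proof. by rewrite linearD !linext1. Qed.

Lemma linext_brLL m n : linext F (nsbr (genL m) (genL n)) =
  (n - m)%:~R *: F (genL (m + n)) +
  ((m + n == 0)%:R * ((m ^+ 3 - m)%:~R / 12)) *: F genC.
Proof. exact: linext2. Qed.

Lemma linext_brLG m k : linext F (nsbr (genL m) (genG k)) =
  (half k - m%:~R / 2) *: F (genG (m + k)).
Proof. exact: linext1. Qed.

Lemma linext_brGL k m : linext F (nsbr (genG k) (genL m)) =
  - (half k - m%:~R / 2) *: F (genG (m + k)).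
Proof. exact: linext1. Qed.

Lemma linext_brGG k l : linext F (nsbr (genG k) (genG l)) =
  2 *: F (genL (k + l + 1)) -
  (3^-1 * (k + l + 1 == 0)%:R * (half k ^+ 2 - 4^-1)) *: F genC.
Proof. by rewrite -scaleNr -linext2 scaleNr. Qed.

Lemma linext_brC g g' : (g == genC) || (g' == genC) -> linext F (nsbr g g') = 0.
Proof. by case: g => [n|n|]; case: g' => [m|m|] // _; rewrite linear0. Qed.

End LinextBr.

Section LinearAction.
Variables (V : lmodType K) (F : nsgen -> {linear V -> V}) (x : NS).

Definition linact v := linext (fun g => F g v) x.

Lemma linact_is_linear : linear linact.
Proof.
move=> a v w; rewrite /linact /= !linext_funE scaler_sumr -big_split /=.
by apply: eq_bigr => g _; rewrite linearP scalerDr !scalerA mulrC.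
Qed.

HB.instance Definition _ := GRing.isLinear.Build K V V *:%R linact linact_is_linear.

End LinearAction.

Section QuotientModule.
Variables (M : nsmod) (N : submodClosed M).
Hypothesis subN : is_submod N.

Lemma quot_par_subproof x : x \in N -> qpi N (nspar x) = 0.
Proof. by case: subN => p _ /p xN; apply/eqP; rewrite qpi_eq0. Qed.

Lemma quot_act_subproof g x : x \in N -> qpi N (nsgact g x) = 0.
Proof.
by case: subN => _ p /(p (nsb g)) xN; apply/eqP; rewrite qpi_eq0 -nsact_nsb.
Qed.

Definition quot_par : {linear quotm N -> quotm N} :=
  qlift (f := qpi N \o nspar) quot_par_subproof.

Definition quot_act g : {linear quotm N -> quotm N} :=
  qlift (f := qpi N \o nsgact g) (quot_act_subproof g).

Lemma quot_parE x : quot_par (qpi N x) = qpi N (nspar x).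
Proof. by rewrite /quot_par qliftE. Qed.

Lemma quot_actE g x : quot_act g (qpi N x) = qpi N (nsgact g x).
Proof. by rewrite /quot_act qliftE. Qed.

Lemma quot_parK : involutive quot_par.
Proof. by elim/qind=> x; rewrite !quot_parE nsparK. Qed.

Lemma quot_par_act g v : quot_par (quot_act g v) = (-1) ^+ isodd g *: quot_act g (quot_par v).
Proof.
by elim/qind: v => v; rewrite quot_parE !quot_actE quot_parE nspar_gact linearZ.
Qed.

Lemma quot_act_br g g' v :
  quot_act g (quot_act g' v) - (-1) ^+ (isodd g && isodd g') *: quot_act g' (quot_act g v) =
  linext (fun k => quot_act k v) (nsbr g g').
Proof.
elim/qind: v => v; rewrite !quot_actE -linearZ -linearB nsgact_br linear_linext; last exact: linearP.
by apply: eq_linext => k; rewrite quot_actE.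
Qed.

Definition quot_mod : nsmod := NsMod quot_parK quot_par_act quot_act_br.

End QuotientModule.

Lemma addr_cancel8 (Z : zmodType) (x x' y z t t' : Z) :
  x + y + (z + t) + (- (x' + z) + - (y + t')) = x - x' + (t - t').
Proof.
rewrite !opprD !addrA [LHS](ACl (1*5*4*8*(2*7)*(3*6)))/=.
by rewrite subrr subrr !addr0.
Qed.

Section TensorModule.
Variables V W : nsmod.

Let tl := @tens_linearl K V W.
Let tr := @tens_linearr K V W.

Lemma tensDl v v' w : tens (v + v') w = tens v w + tens v' w :> tensor V W.
Proof. by rewrite -[v]scale1r tl !scale1r. Qed.
Lemma tensZl a v w : tens (a *: v) w = a *: tens v w :> tensor V W.
Proof.
have t0 : tens 0 w = 0 :> tensor V W.
  by have := tl w 1 0 0; rewrite !scale1r addr0 => /esym/eqP; rewrite -subr_eq0 addrK => /eqP.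
by have := tl w a v 0; rewrite !addr0 t0 addr0.
Qed.
Lemma tensDr v w w' : tens v (w + w') = tens v w + tens v w' :> tensor V W.
Proof. by rewrite -[w]scale1r tr !scale1r. Qed.
Lemma tensZr a v w : tens v (a *: w) = a *: tens v w :> tensor V W.
Proof.
have t0 : tens v 0 = 0 :> tensor V W.
  by have := tr v 1 0 0; rewrite !scale1r addr0 => /esym/eqP; rewrite -subr_eq0 addrK => /eqP.
by have := tr v a w 0; rewrite !addr0 t0 addr0.
Qed.

Lemma tensBZl e v v' w :
  tens (v - e *: v') w = tens v w - e *: tens v' w :> tensor V W.
Proof. by rewrite tensDl -scaleNr tensZl scaleNr. Qed.
Lemma tensBZr e v w w' :
  tens v (w - e *: w') = tens v w - e *: tens v w' :> tensor V W.
Proof. by rewrite tensDr -scaleNr tensZr scaleNr. Qed.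

Definition tpar_fun (v : V) (w : W) : tensor V W := tens (nspar v) (nspar w).

(* [iter (isodd g) nspar v] is (-1)^(|g||v|) v for homogeneous [v] *)
Definition tact_fun g (v : V) (w : W) : tensor V W :=
  tens (nsgact g v) w + tens (iter (isodd g) nspar v) (nsgact g w).

Lemma tpar_l w : linear (tpar_fun^~ w).
Proof. by move=> a v v'; rewrite /tpar_fun linearP tl. Qed.
Lemma tpar_r v : linear (tpar_fun v).
Proof. by move=> a w w'; rewrite /tpar_fun linearP tr. Qed.
Lemma tact_l g w : linear ((tact_fun g)^~ w).
Proof.
move=> a v v'; rewrite /tact_fun linearP tl.
have -> : iter (isodd g) nspar (a *: v + v') =
  a *: iter (isodd g) nspar v + iter (isodd g) nspar v'.
  by case: isodd => //=; rewrite linearP.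
by rewrite tl scalerDr addrACA.
Qed.
Lemma tact_r g v : linear (tact_fun g v).
Proof. by move=> a w w'; rewrite /tact_fun linearP !tr scalerDr addrACA. Qed.

Definition tens_par : {linear tensor V W -> tensor V W} := tlift tpar_l tpar_r.

Definition tens_act g : {linear tensor V W -> tensor V W} :=
  tlift (tact_l g) (tact_r g).

Lemma tens_parE v w : tens_par (tens v w) = tens (nspar v) (nspar w).
Proof. exact: tliftE. Qed.

Lemma tens_actE g v w : tens_act g (tens v w) =
  tens (nsgact g v) w + tens (iter (isodd g) nspar v) (nsgact g w).
Proof. exact: tliftE. Qed.

Lemma tens_parK : involutive tens_par.
Proof.
apply: (@linear_tens _ _ _ _ (fun x => tens_par (tens_par x)) (fun x => x)).
- by move=> a x y; rewrite !linearP.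
- by [].
- by move=> v w; rewrite !tens_parE !nsparK.
Qed.

Lemma tens_par_act g x :
  tens_par (tens_act g x) = (-1) ^+ isodd g *: tens_act g (tens_par x).
Proof.
move: x; apply: (@linear_tens _ _ _ _ (fun x => tens_par (tens_act g x))
  (fun x => (-1) ^+ isodd g *: tens_act g (tens_par x))).
- by move=> a x y; rewrite !linearP.
- by move=> a x y; rewrite !linearP.
- move=> v w; rewrite tens_parE !tens_actE linearD !tens_parE !nspar_gact.
  rewrite tensZl tensZr scalerDr.
  by case: (isodd g).
Qed.

Lemma tens_act_br g g' x :
  tens_act g (tens_act g' x) - (-1) ^+ (isodd g && isodd g') *: tens_act g' (tens_act g x) =
  linext (fun k => tens_act k x) (nsbr g g').
Proof.
pose e : K := (-1) ^+ (isodd g && isodd g'); rewrite -/e.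
move: x; apply: (@linear_tens _ _ _ _
  (fun x => tens_act g (tens_act g' x) - e *: tens_act g' (tens_act g x))
  (linact tens_act (nsbr g g'))).
- move=> a x y; by rewrite !linearP scalerDr addrACA.
- exact: linact_is_linear.
move=> v w; rewrite !tens_actE !linearD !tens_actE /linact.
rewrite (eq_linext (fun k => tens_actE k v w)).
have -> : linext (fun k => tens (nsgact k v) w +
    tens (iter (isodd k) nspar v) (nsgact k w)) (nsbr g g') =
  linext (fun k => tens (nsgact k v) w : tensor V W) (nsbr g g') +
  linext (fun k => tens (iter (isodd k) nspar v) (nsgact k w) : tensor V W) (nsbr g g').
  rewrite /= !linext_funE -big_split; apply: eq_bigr => k _.
  by rewrite scalerDr.
set s := iter (isodd g (+) isodd g') nspar v.
rewrite [X in _ = _ + X](@linext_nsbr _ _ (fun k => tens s (nsgact k w))); last first.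
  by move=> k kE; rewrite kE.
rewrite -(linear_linext _ _ (tl w)) -(linear_linext _ _ (tr s)).
rewrite -!nsgact_br tensBZl tensBZr -/e.
have -> : iter (isodd g') nspar (iter (isodd g) nspar v) = s.
  by rewrite /s; case: (isodd g); case: (isodd g'); rewrite //= nsparK.
have -> : iter (isodd g) nspar (iter (isodd g') nspar v) = s.
  by rewrite /s; case: (isodd g); case: (isodd g'); rewrite //= nsparK.
have sw h h' u : (-1) ^+ (isodd h && isodd h') *: nsgact h' (iter (isodd h) nspar u) =
  iter (isodd h) nspar (nsgact h' u) :> V.
  case: (isodd h) => /=; last by rewrite expr0 scale1r.
  by rewrite nspar_gact.
have sw1 : e *: tens (nsgact g' (iter (isodd g) nspar v)) (nsgact g w) =
    tens (iter (isodd g) nspar (nsgact g' v)) (nsgact g w) :> tensor V W.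
  by rewrite -tensZl /e sw.
have sw2 : e *: tens (iter (isodd g') nspar (nsgact g v)) (nsgact g' w) =
    tens (nsgact g (iter (isodd g') nspar v)) (nsgact g' w) :> tensor V W.
  by rewrite -tensZl -sw /e [isodd g && _]andbC scalerA -expr2 sqrr_sign scale1r.
rewrite /= !scalerDr sw1 sw2.
exact: addr_cancel8.
Qed.

Definition tensor_mod : nsmod := NsMod tens_parK tens_par_act tens_act_br.

End TensorModule.

Local Notation freeNS := {malg K[{fmonom nsgen}]}.

Definition fgen (g : nsgen) : freeNS := bas K (fmu g).
Definition fincl : {linear NS -> freeNS} := linext fgen.

Definition urel (g g' : nsgen) : freeNS :=
  fgen g * fgen g' - (-1) ^+ (isodd g && isodd g') *: (fgen g' * fgen g)
  - fincl (nsbr g g').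

Inductive uideal_gen : set freeNS :=
| UIdealGen p g g' q : uideal_gen (p * urel g g' * q).

Definition uideal : submodClosed freeNS := span uideal_gen.

Definition Unv := quotm uideal.
HB.instance Definition _ := GRing.Lmodule.on Unv.

Lemma freeNS_scaleAl a (p q : freeNS) : a *: (p * q) = (a *: p) * q.
Proof. exact: scalerAl. Qed.

Lemma freeNS_mulC a (p : freeNS) : p * malgC a = a *: p.
Proof.
rewrite (malgMEw (fsubset_refl _) (@msuppC_le {fmonom nsgen} K a)).
rewrite [in RHS](malg_scaleU p) scaler_sumr; apply: eq_bigr => k _.
rewrite big_seq_fset1 mcoeffC eqxx mulr1n mulm1; apply/malgP => l.
by rewrite mcoeffU !mcoeffZ mcoeff_bas mulrA [a * _]mulrC mulr_natr.
Qed.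

Lemma freeNS_scaleAr a (p q : freeNS) : a *: (p * q) = p * (a *: q).
Proof. by rewrite -(mul_malgC a q) mulrA freeNS_mulC scalerAl. Qed.

Lemma freeNS_mulZZ a e (p q : freeNS) : (a *: p) * (e *: q) = (a * e) *: (p * q).
Proof. by rewrite -freeNS_scaleAl -freeNS_scaleAr scalerA. Qed.

Lemma uideal_mull p x : x \in uideal -> p * x \in uideal.
Proof.
apply: (span_linear (f := fun x => p * x)) => [a y z|_ [q g g' r]].
  by rewrite mulrDr freeNS_scaleAr.
have mA (s u y z : freeNS) : s * (y * u * z) = (s * y) * u * z by rewrite !mulrA.
rewrite mA.
exact: mem_span (UIdealGen _ _ _ _).
Qed.

Lemma uideal_mulr p x : x \in uideal -> x * p \in uideal.
Proof.
apply: (span_linear (f := fun x => x * p)) => [a y z|_ [q g g' r]].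
  by rewrite mulrDl freeNS_scaleAl.
have mA (s u y z : freeNS) : s * u * y * z = s * u * (y * z) by exact: esym (mulrA _ _ _).
rewrite mA.
exact: mem_span (UIdealGen _ _ _ _).
Qed.

Lemma urel_in g g' : urel g g' \in uideal.
Proof.
have -> : urel g g' = 1 * urel g g' * 1 by rewrite mulr1 mul1r.
exact: mem_span (UIdealGen _ _ _ _).
Qed.

Definition upi (p : freeNS) : Unv := qpi uideal p.

Lemma uind (P : Unv -> Prop) : (forall p, P (upi p)) -> forall x, P x.
Proof. exact: qind. Qed.

Lemma upi_is_linear : linear upi. Proof. exact: linearP. Qed.
HB.instance Definition _ := GRing.isLinear.Build K freeNS Unv *:%R upi upi_is_linear.

Lemma upiZ a p : upi (a *: p) = a *: upi p. Proof. exact: linearZ. Qed.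
Lemma upiD p q : upi (p + q) = upi p + upi q. Proof. exact: linearD. Qed.

Definition umul : Unv -> Unv -> Unv :=
  locked_with seal_key (fun x y => upi (repr x * repr y)).

Lemma upi_mul p q : umul (upi p) (upi q) = upi (p * q).
Proof.
rewrite /umul locked_withE; apply/qpiP.
have -> : repr (upi p) * repr (upi q) - p * q =
   (repr (upi p) - p) * repr (upi q) + p * (repr (upi q) - q).
  by rewrite mulrBl mulrBr addrA subrK.
by apply: rpredD; [apply: uideal_mulr | apply: uideal_mull]; exact: repr_qpi.
Qed.

Lemma umulA : associative umul.
Proof. by elim/uind=> x; elim/uind=> y; elim/uind=> z; rewrite !upi_mul mulrA. Qed.
Lemma umul1 : left_id (upi 1) umul.
Proof. by elim/uind=> x; rewrite upi_mul mul1r. Qed.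
Lemma umulr1 : right_id (upi 1) umul.
Proof. by elim/uind=> x; rewrite upi_mul mulr1. Qed.
Lemma umulDl : left_distributive umul +%R.
Proof.
by elim/uind=> x; elim/uind=> y; elim/uind=> z; rewrite -upiD !upi_mul mulrDl upiD.
Qed.
Lemma umulDr : right_distributive umul +%R.
Proof.
by elim/uind=> x; elim/uind=> y; elim/uind=> z; rewrite -upiD !upi_mul mulrDr upiD.
Qed.

HB.instance Definition _ := GRing.Zmodule_isPzRing.Build Unv
  umulA umul1 umulr1 umulDl umulDr.

Lemma upiM p q : upi (p * q) = upi p * upi q.
Proof. by rewrite -upi_mul. Qed.

Lemma uscaleAl a (x y : Unv) : a *: (x * y) = (a *: x) * y.
Proof.
by elim/uind: x => x; elim/uind: y => y; rewrite -upiZ -!upiM -upiZ freeNS_scaleAl.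
Qed.

Lemma uscaleAr a (x y : Unv) : a *: (x * y) = x * (a *: y).
Proof.
elim/uind: x => x; elim/uind: y => y.
by rewrite -upiZ -!upiM -upiZ freeNS_scaleAr.
Qed.

Definition ugen (g : nsgen) : Unv := upi (fgen g).

Definition uincl (s : NS) : Unv := linext ugen s.

Lemma ugen_br g g' :
  ugen g * ugen g' - (-1) ^+ (isodd g && isodd g') *: (ugen g' * ugen g) =
  uincl (nsbr g g').
Proof.
rewrite /ugen -!upiM -linearZ -linearB /uincl.
have -> : linext (upi \o fgen) (nsbr g g') = upi (fincl (nsbr g g')).
  by rewrite /fincl linear_linext //; exact: linearP.
by apply/qpiP; exact: urel_in.
Qed.

(* The grading of U(NS): the automorphism g |-> (-1)^|g| g. *)
Definition fpar : {linear freeNS -> freeNS} :=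
  linext (fun w : {fmonom nsgen} => (-1) ^+ count isodd w *: bas K w).

Lemma fparE (w : {fmonom nsgen}) : fpar (bas K w) = (-1) ^+ count isodd w *: bas K w.
Proof. exact: linextE. Qed.

Lemma fparM p q : fpar (p * q) = fpar p * fpar q.
Proof.
move: p; apply: (linear_bas (f := fun p => fpar (p * q)) (g := fun p => fpar p * fpar q)).
- by move=> a x y; rewrite mulrDl -freeNS_scaleAl linearP.
- by move=> a x y; rewrite linearP mulrDl freeNS_scaleAl.
move=> w; move: q.
apply: (linear_bas (f := fun q => fpar (bas K w * q)) (g := fun q => fpar (bas K w) * fpar q)).
- by move=> a x y; rewrite mulrDr -freeNS_scaleAr linearP.
- by move=> a x y; rewrite linearP mulrDr freeNS_scaleAr.
move=> w'; by rewrite basM !fparE fmM count_cat exprD freeNS_mulZZ basM.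
Qed.

Lemma fparK : involutive fpar.
Proof.
apply: (linear_bas (f := fun p => fpar (fpar p)) (g := fun p => p)) => // [a x y|w].
  by rewrite !linearP.
by rewrite fparE linearZ /= fparE scalerA -expr2 sqrr_sign scale1r.
Qed.

Lemma fpar_gen g : fpar (fgen g) = (-1) ^+ isodd g *: fgen g.
Proof. by rewrite fparE fmU /= addn0. Qed.

Lemma eigen_comm (V : lmodType K) (f : {linear V -> V}) a k (u v r : V) :
  f u = a *: u -> f v = a *: v -> f r = a *: r ->
  f (u - k *: v - r) = a *: (u - k *: v - r).
Proof.
by move=> fu fv fr; rewrite !linearB linearZ /= fu fv fr !scalerA [k * _]mulrC.
Qed.

Lemma fpar_comm a e k (p q r : freeNS) :
  fpar p = a *: p -> fpar q = e *: q -> fpar r = (a * e) *: r ->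
  fpar (p * q - k *: (q * p) - r) = (a * e) *: (p * q - k *: (q * p) - r).
Proof.
move=> fp fq fr; apply: eigen_comm; last exact: fr.
  by rewrite fparM fp fq; exact: freeNS_mulZZ.
by rewrite fparM fp fq [a * e]mulrC; exact: freeNS_mulZZ.
Qed.

Lemma fpar_urel g g' : fpar (urel g g') = (-1) ^+ (isodd g (+) isodd g') *: urel g g'.
Proof.
rewrite signr_addb; apply: fpar_comm; try exact: fpar_gen.
rewrite -signr_addb /fincl linear_linext; last exact: linearP.
rewrite (@linext_nsbr _ _ (fun k => (-1) ^+ (isodd g (+) isodd g') *: fgen k)); last first.
  by move=> k <-; exact: fpar_gen.
rewrite -(linear_linext (f := *:%R ((-1) ^+ (isodd g (+) isodd g'))) fgen) //.
exact: linearP.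
Qed.

Lemma upar_subproof x : x \in uideal -> upi (fpar x) = 0.
Proof.
move=> xI; apply/eqP; rewrite qpi_eq0; move: x xI.
apply: (span_linear (linearP _)) => _ [p g g' q].
have e3 (x y z : freeNS) : fpar (x * y * z) = fpar x * fpar y * fpar z.
  by rewrite !fparM.
rewrite e3; apply: uideal_mulr; apply: uideal_mull.
by rewrite fpar_urel; apply: rpredZ; exact: urel_in.
Qed.

Definition upar : {linear Unv -> Unv} := qlift (f := upi \o fpar) upar_subproof.

Lemma uparE p : upar (upi p) = upi (fpar p). Proof. exact: qliftE. Qed.

Lemma uparM x y : upar (x * y) = upar x * upar y.
Proof.
by elim/uind: x => p; elim/uind: y => q; rewrite -upiM !uparE fparM upiM.
Qed.

Lemma uparK : involutive upar.
Proof. by elim/uind=> p; rewrite !uparE fparK. Qed.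

Lemma upar_gen g : upar (ugen g) = (-1) ^+ isodd g *: ugen g.
Proof. by rewrite uparE fpar_gen linearZ. Qed.

Lemma uincl_linear : linear uincl. Proof. exact: linearP. Qed.

Definition nspar_NS : {linear NS -> NS} :=
  linext (fun g => (-1) ^+ isodd g *: nsb g).

Lemma nspar_NSE g : nspar_NS (nsb g) = (-1) ^+ isodd g *: nsb g.
Proof. exact: linextE. Qed.

Lemma uincl_nsb g : uincl (nsb g) = ugen g. Proof. exact: linextE. Qed.

Lemma uinclZ a s : uincl (a *: s) = a *: uincl s. Proof. exact: linearZ. Qed.

Lemma upar_incl s : upar (uincl s) = uincl (nspar_NS s).
Proof.
move: s; apply: (linear_bas (f := fun s => upar (uincl s)) (g := fun s => uincl (nspar_NS s))).
- by move=> a x y; rewrite uincl_linear linearP.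
- by move=> a x y; rewrite linearP uincl_linear.
move=> g; rewrite nspar_NSE uinclZ uincl_nsb.
exact: upar_gen.
Qed.

(* Basis elements spanning b+ ; note that k + 1/2 > 0 iff k >= 0. *)
Definition in_bplus (g : nsgen) : bool :=
  match g with genL n => 0 <= n | genG k => 0 <= k | genC => true end.

Definition bplus : submodClosed NS :=
  span [set x | exists2 g, in_bplus g & x = nsb g].

Section Verma.
Variables c h : K.

(* The action of b+ on the line C u, i.e. n+ u = 0, L_0 u = h u and C u = c u. *)
Definition hwchar (s : NS) : K := h * s@_(genL 0) + c * s@_genC.

(* Balancing relations of the tensor product of U(NS) with C u over U(b+). As
   U(b+) is generated by b+, they need only be imposed for the elements of b+. *)
Inductive verma_rel : set (tensor Unv K^o) :=
| VermaRel x s z : s \in bplus ->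
    verma_rel (tens (x * uincl s) z - tens x (hwchar s *: z)).

Definition verma_car := quotm (span verma_rel).
HB.instance Definition _ := GRing.Lmodule.on verma_car.

Definition vtens (x : Unv) (z : K^o) : verma_car := qpi (span verma_rel) (tens x z).

Lemma vpar_l z : linear (fun x : Unv => vtens (upar x) z).
Proof. by move=> a x y; rewrite /vtens linearP tens_linearl linearP. Qed.
Lemma vpar_r x : linear (fun z : K^o => vtens (upar x) z).
Proof. by move=> a z t; rewrite /vtens tens_linearr linearP. Qed.
Lemma vact_l g z : linear (fun x : Unv => vtens (ugen g * x) z).
Proof.
by move=> a x y; rewrite /vtens mulrDr -uscaleAr tens_linearl linearP.
Qed.
Lemma vact_r g x : linear (fun z : K^o => vtens (ugen g * x) z).
Proof. by move=> a z t; rewrite /vtens tens_linearr linearP. Qed.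

Lemma vtens_rel x s z : s \in bplus -> vtens (x * uincl s) z = vtens x (hwchar s *: z).
Proof. by move=> sb; apply/qpiP/mem_span; constructor. Qed.

Lemma hwchar_linear : linear (hwchar : NS -> K^o).
Proof.
move=> a x y; rewrite /hwchar !mcoeffD !mcoeffZ.
by rewrite /GRing.scale /=; ring.
Qed.

Lemma vact_subproof g t : t \in span verma_rel -> tlift (vact_l g) (vact_r g) t = 0.
Proof.
apply: (span_eq0 (linearP _)) => _ [x s z sb].
by rewrite linearB !tliftE mulrA vtens_rel // subrr.
Qed.

Lemma hwchar_par s : hwchar (nspar_NS s) = hwchar s.
Proof.
move: s; apply: (linear_bas (W := K^o) (f := fun s => hwchar (nspar_NS s)) (g := hwchar)).
- by move=> a x y; rewrite linearP hwchar_linear.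
- exact: hwchar_linear.
move=> g; rewrite nspar_NSE /hwchar !mcoeffZ !mcoeff_bas.
by case: g => [n|k|] /=; rewrite ?expr0 ?mul1r // !mulr0.
Qed.

Lemma bplus_par s : s \in bplus -> nspar_NS s \in bplus.
Proof.
apply: (span_linear (linearP _)) => _ [g gb ->].
rewrite nspar_NSE; apply: rpredZ; apply: mem_span; by exists g.
Qed.

Lemma vpar_subproof t : t \in span verma_rel -> tlift vpar_l vpar_r t = 0.
Proof.
apply: (span_eq0 (linearP _)) => _ [x s z sb].
rewrite linearB !tliftE uparM upar_incl; apply/eqP; rewrite subr_eq0; apply/eqP.
by rewrite -(hwchar_par s); apply: vtens_rel; exact: bplus_par.
Qed.

Definition verma_par : {linear verma_car -> verma_car} := qlift vpar_subproof.
Definition verma_act g : {linear verma_car -> verma_car} := qlift (vact_subproof g).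

Lemma verma_parE x z : verma_par (vtens x z) = vtens (upar x) z.
Proof. by rewrite /verma_par qliftE tliftE. Qed.

Lemma verma_actE g x z : verma_act g (vtens x z) = vtens (ugen g * x) z.
Proof. by rewrite /verma_act qliftE tliftE. Qed.

Lemma linear_vtens (X : lmodType K) (f f' : verma_car -> X) :
  linear f -> linear f' -> (forall x z, f (vtens x z) = f' (vtens x z)) -> f =1 f'.
Proof.
move=> fl fl' ff; elim/qind => t; move: t.
apply: (linear_tens (f := fun t => f (qpi _ t)) (g := fun t => f' (qpi _ t))) => //.
- by move=> a x y; rewrite linearP fl.
- by move=> a x y; rewrite linearP fl'.
Qed.

Lemma verma_parK : involutive verma_par.
Proof.
apply: (linear_vtens (f := fun t => verma_par (verma_par t)) (f' := fun t => t)) => //.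
- by move=> a x y; rewrite !linearP.
- by move=> x z; rewrite !verma_parE uparK.
Qed.

Lemma vtens_linear z : linear (vtens^~ z).
Proof. by move=> a x y; rewrite /vtens tens_linearl linearP. Qed.

Lemma vtensZ a x z : vtens (a *: x) z = a *: vtens x z.
Proof.
have v0 : vtens 0 z = 0.
  have := vtens_linear z 1 0 0; rewrite !scale1r addr0.
  by move/esym/eqP; rewrite -subr_eq0 addrK => /eqP.
by have := vtens_linear z a x 0; rewrite !addr0 v0 addr0.
Qed.

Lemma vtensBZ a x y z : vtens (x - a *: y) z = vtens x z - a *: vtens y z.
Proof. by have := vtens_linear z (- a) y x; rewrite !scaleNr ![- (a *: _) + _]addrC. Qed.

Lemma verma_par_act g v :
  verma_par (verma_act g v) = (-1) ^+ isodd g *: verma_act g (verma_par v).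
Proof.
move: v; apply: (linear_vtens (f := fun v => verma_par (verma_act g v))
  (f' := fun v => (-1) ^+ isodd g *: verma_act g (verma_par v))).
- by move=> a x y; rewrite !linearP.
- by move=> a x y; rewrite !linearP.
move=> x z; rewrite verma_actE !verma_parE verma_actE uparM upar_gen.
by rewrite -uscaleAl vtensZ.
Qed.

Lemma verma_act_br g g' v :
  verma_act g (verma_act g' v) -
    (-1) ^+ (isodd g && isodd g') *: verma_act g' (verma_act g v) =
  linext (fun k => verma_act k v) (nsbr g g').
Proof.
set e := (-1) ^+ _.
move: v; apply: (linear_vtens
  (f := fun v => verma_act g (verma_act g' v) - e *: verma_act g' (verma_act g v))
  (f' := linact verma_act (nsbr g g'))).
- by move=> a x y; rewrite !linearP scalerDr addrACA.
- exact: linact_is_linear.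
move=> x z; rewrite !verma_actE -vtensBZ !mulrA uscaleAl -mulrBl ugen_br.
rewrite /linact (eq_linext (fun k => verma_actE k x z)).
rewrite -(linear_linext (f := fun y : Unv => vtens (y * x) z) ugen) // => a y y'.
by rewrite /vtens mulrDl -uscaleAl tens_linearl linearP.
Qed.

Definition verma : nsmod := NsMod verma_parK verma_par_act verma_act_br.

End Verma.

(* V(c,h) is the unique simple quotient of M(c,h); a statement about V(c,h) is
   made for an arbitrary [V : simple_quotient (verma c h)]. *)
Record simple_quotient (M : nsmod) := SimpleQuotient {
  sq_ker : submodClosed M;
  sq_kerP : is_submod sq_ker;
  sq_simple : is_simple (quot_mod sq_kerP)
}.

Definition sq_mod (M : nsmod) (Q : simple_quotient M) : nsmod := quot_mod (sq_kerP Q).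

Section SA.
Variables a b : K.

(* [inl i] indexes x_i and [inr i] indexes y_{i+1/2} *)
Local Notation sa_car := {malg K[(int + int)%type]}.

Definition sa_x (i : int) : sa_car := bas K (inl i).
Definition sa_y (i : int) : sa_car := bas K (inr i).

Definition sa_par : {linear sa_car -> sa_car} :=
  linext (fun e : int + int => match e with inl i => sa_x i | inr i => - sa_y i end).

Definition sa_act (g : nsgen) : {linear sa_car -> sa_car} :=
  linext (fun e : int + int =>
    match g, e with
    | genL i, inl j => (a + j%:~R + i%:~R * b) *: sa_x (i + j)
    | genL i, inr j => (a + 2^-1 + j%:~R + i%:~R * (b - 2^-1)) *: sa_y (i + j)
    | genG i, inl j => sa_y (i + j)
    | genG i, inr j =>
        (a + 2^-1 + j%:~R + 2 * (2^-1 + i%:~R) * (b - 2^-1)) *: sa_x (1 + i + j)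
    | genC, _ => 0
    end).

Lemma sa_parxE i : sa_par (sa_x i) = sa_x i. Proof. exact: linextE. Qed.
Lemma sa_paryE i : sa_par (sa_y i) = - sa_y i. Proof. exact: linextE. Qed.
Lemma sa_Lx i j : sa_act (genL i) (sa_x j) = (a + j%:~R + i%:~R * b) *: sa_x (i + j).
Proof. exact: linextE. Qed.
Lemma sa_Ly i j : sa_act (genL i) (sa_y j) =
  (a + 2^-1 + j%:~R + i%:~R * (b - 2^-1)) *: sa_y (i + j).
Proof. exact: linextE. Qed.
Lemma sa_Gx i j : sa_act (genG i) (sa_x j) = sa_y (i + j).
Proof. exact: linextE. Qed.
Lemma sa_Gy i j : sa_act (genG i) (sa_y j) =
  (a + 2^-1 + j%:~R + 2 * (2^-1 + i%:~R) * (b - 2^-1)) *: sa_x (1 + i + j).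
Proof. exact: linextE. Qed.
Lemma sa_Cx j : sa_act genC (sa_x j) = 0. Proof. exact: linextE. Qed.
Lemma sa_Cy j : sa_act genC (sa_y j) = 0. Proof. exact: linextE. Qed.

Definition sa_E := (sa_parxE, sa_paryE, sa_Lx, sa_Ly, sa_Gx, sa_Gy, sa_Cx, sa_Cy).

Lemma linear_sa (X : lmodType K) (f f' : sa_car -> X) :
  linear f -> linear f' -> (forall i, f (sa_x i) = f' (sa_x i)) ->
  (forall i, f (sa_y i) = f' (sa_y i)) -> f =1 f'.
Proof. by move=> fl fl' fx fy; apply: linear_bas => // -[]. Qed.

Lemma sa_parK : involutive sa_par.
Proof.
apply: (linear_sa (f := fun v => sa_par (sa_par v)) (f' := fun v => v)) => //.
- by move=> k x y; rewrite !linearP.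
- by move=> i; rewrite !sa_E.
- by move=> i; rewrite sa_E linearN sa_E opprK.
Qed.

Lemma sa_par_act g v : sa_par (sa_act g v) = (-1) ^+ isodd g *: sa_act g (sa_par v).
Proof.
move: v; apply: (linear_sa (f := fun v => sa_par (sa_act g v))
   (f' := fun v => (-1) ^+ isodd g *: sa_act g (sa_par v))).
- by move=> k x y; rewrite !linearP.
- by move=> k x y; rewrite !linearP.
- move=> i; rewrite sa_parxE; case: g => [n|n|].
  + by rewrite sa_Lx linearZ /= sa_parxE expr0 scale1r.
  + by rewrite sa_Gx sa_paryE expr1 scaleN1r.
  + by rewrite sa_Cx linear0 scaler0.
- move=> i; rewrite sa_paryE linearN; case: g => [n|n|].
  + by rewrite sa_Ly linearZ /= sa_paryE expr0 scale1r scalerN.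
  + by rewrite sa_Gy linearZ /= sa_parxE expr1 scaleN1r opprK.
  + by rewrite sa_Cy linear0 oppr0 scaler0.
Qed.

Lemma sa_act_br g g' v :
  sa_act g (sa_act g' v) - (-1) ^+ (isodd g && isodd g') *: sa_act g' (sa_act g v) =
  linext (fun k => sa_act k v) (nsbr g g').
Proof.
set e := (-1) ^+ _.
move: v; apply: (linear_sa
  (f := fun v => sa_act g (sa_act g' v) - e *: sa_act g' (sa_act g v))
  (f' := linact sa_act (nsbr g g'))).
- by move=> k x y; rewrite !linearP scalerDr addrACA.
- exact: linact_is_linear.
- have Zx n i c : sa_act n (c *: sa_x i) = c *: sa_act n (sa_x i) by exact: linearZ.
  have Zy n i c : sa_act n (c *: sa_y i) = c *: sa_act n (sa_y i) by exact: linearZ.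
  have N0 n : sa_act n 0 = 0 by exact: linear0.
  move=> i; rewrite /linact.
  case: g g' @e => [n|n|] [m|m|] e; rewrite /e ?expr0 ?expr1 ?scale1r ?scaleN1r ?opprK.
  + have I1 : n + (m + i) = n + m + i by ring.
    have I2 : m + (n + i) = n + m + i by ring.
    have LL p q : sa_act (genL p) (sa_act (genL q) (sa_x i)) =
        ((a + i%:~R + q%:~R * b) * (a + (q + i)%:~R + p%:~R * b)) *: sa_x (p + (q + i)).
      by rewrite sa_Lx Zx sa_Lx scalerA.
    rewrite linext_brLL LL (LL m n) sa_Lx sa_Cx scaler0 addr0 I1 I2 scalerA -scalerBl.
    by congr (_ *: _); rewrite !intrD; ring.
  + have I1 : n + (m + i) = n + m + i by ring.
    have I2 : m + (n + i) = n + m + i by ring.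
    rewrite linext_brLG !sa_Gx !sa_Lx !sa_Ly Zx !sa_Gx I1 I2 -scalerBl.
    by congr (_ *: _); rewrite /half !intrD; field.
  + by rewrite linext_brC // sa_Cx sa_Lx Zx sa_Cx scaler0 N0 subrr.
  + have I1 : n + (m + i) = m + n + i by ring.
    have I2 : m + (n + i) = m + n + i by ring.
    rewrite linext_brGL !sa_Gx !sa_Lx !sa_Ly Zx !sa_Gx I1 I2 -scalerBl.
    by congr (_ *: _); rewrite /half !intrD; field.
  + have I1 : 1 + n + (m + i) = n + m + 1 + i by ring.
    have I2 : 1 + m + (n + i) = n + m + 1 + i by ring.
    rewrite linext_brGG !sa_Gx !sa_Gy sa_Lx sa_Cx scaler0 subr0 I1 I2 -scalerDl scalerA.
    by congr (_ *: _); rewrite !intrD; field.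
  + by rewrite linext_brC // sa_Cx sa_Gx sa_Cy N0 subrr.
  + by rewrite linext_brC // sa_Cx sa_Lx Zx sa_Cx scaler0 N0 subrr.
  + by rewrite linext_brC // sa_Cx sa_Gx sa_Cy N0 subrr.
  + by rewrite linext_brC // sa_Cx N0 subrr.
have Zx n i c : sa_act n (c *: sa_x i) = c *: sa_act n (sa_x i) by exact: linearZ.
have Zy n i c : sa_act n (c *: sa_y i) = c *: sa_act n (sa_y i) by exact: linearZ.
have N0 n : sa_act n 0 = 0 by exact: linear0.
move=> i; rewrite /linact.
case: g g' @e => [n|n|] [m|m|] e; rewrite /e ?expr0 ?expr1 ?scale1r ?scaleN1r ?opprK.
+ have I1 : n + (m + i) = n + m + i by ring.
  have I2 : m + (n + i) = n + m + i by ring.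
  have LL p q : sa_act (genL p) (sa_act (genL q) (sa_y i)) =
      ((a + 2^-1 + i%:~R + q%:~R * (b - 2^-1)) *
       (a + 2^-1 + (q + i)%:~R + p%:~R * (b - 2^-1))) *: sa_y (p + (q + i)).
    by rewrite sa_Ly Zy sa_Ly scalerA.
  rewrite linext_brLL LL (LL m n) sa_Ly sa_Cy scaler0 addr0 I1 I2 scalerA -scalerBl.
  by congr (_ *: _); rewrite !intrD; ring.
+ have I1 : n + (1 + m + i) = 1 + (n + m) + i by ring.
  have I2 : 1 + m + (n + i) = 1 + (n + m) + i by ring.
  rewrite linext_brLG !sa_Gy !sa_Ly Zx Zy sa_Lx !sa_Gy I1 I2 !scalerA -scalerBl.
  by congr (_ *: _); rewrite /half !intrD; field.
+ by rewrite linext_brC // sa_Cy sa_Ly Zy sa_Cy scaler0 N0 subrr.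
+ have I1 : m + (1 + n + i) = 1 + (m + n) + i by ring.
  have I2 : 1 + n + (m + i) = 1 + (m + n) + i by ring.
  rewrite linext_brGL !sa_Gy !sa_Ly Zx Zy sa_Lx !sa_Gy I1 I2 !scalerA -scalerBl.
  by congr (_ *: _); rewrite /half !intrD; field.
+ have I1 : n + (1 + m + i) = n + m + 1 + i by ring.
  have I2 : m + (1 + n + i) = n + m + 1 + i by ring.
  rewrite linext_brGG !sa_Gy !Zx !sa_Gx sa_Ly sa_Cy scaler0 subr0 I1 I2 -scalerDl scalerA.
  by congr (_ *: _); rewrite !intrD; field.
+ by rewrite linext_brC // sa_Cy sa_Gy Zx sa_Cx scaler0 N0 subrr.
+ by rewrite linext_brC // sa_Cy sa_Ly Zy sa_Cy scaler0 N0 subrr.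
+ by rewrite linext_brC // sa_Cy sa_Gy Zx sa_Cx scaler0 N0 subrr.
+ by rewrite linext_brC // sa_Cy N0 subrr.
Qed.

Definition SA : nsmod := NsMod sa_parK sa_par_act sa_act_br.

End SA.

(* [sa_y (-1)] is y_{-1/2}. *)
Definition sa_line : submodClosed (SA 2^-1 2^-1) := span [set sa_y (-1)].

Lemma sa_line_sub : is_submod sa_line.
Proof.
split; first apply: (span_linear (linearP _)) => _ ->.
  by rewrite [nspar _]sa_paryE qequivN; apply: mem_span.
move=> x v vN.
have vN' g w : w \in sa_line -> nsgact g w \in sa_line.
  move: w; apply: (span_linear (linearP _)) => _ ->.
  case: g => [n|n|].
  - rewrite [nsgact _ _]sa_Ly.
    have -> : 2^-1 + 2^-1 + (-1)%:~R + n%:~R * (2^-1 - 2^-1) = 0 :> K by field.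
    by rewrite scale0r rpred0.
  - rewrite [nsgact _ _]sa_Gy.
    have -> : 2^-1 + 2^-1 + (-1)%:~R + 2 * (2^-1 + n%:~R) * (2^-1 - 2^-1) = 0 :> K by field.
    by rewrite scale0r rpred0.
  - by rewrite [nsgact _ _]sa_Cy rpred0.
rewrite /nsact /= linext_funE; apply: rpred_sum => g _; apply: rpredZ; exact: vN'.
Qed.

Definition SA' (a b : K) : nsmod :=
  if (a == 2^-1) && (b == 2^-1) then quot_mod sa_line_sub else SA a b.

End NS.

(* Main.v *)
Require Import Defs.
From HB Require Import structures.
From mathcomp Require Import all_boot all_order all_algebra reals complex.
From mathcomp Require Import boolp classical_sets ring lra zify.
From mathcomp.multinomials Require Import monalg.

Set Implicit Arguments.
Unset Strict Implicit.
Unset Printing Implicit Defensive.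

Import Order.TTheory GRing.Theory Num.Theory.
Local Open Scope ring_scope.

(* Every vector of V(c,h) is killed by all modes of large degree, so on a given
   vector of V(c,h) (x) SA'_{a,b} these modes act through the second factor only.
   There the difference D = G_{n+1} G_m - G_n G_{m+1} is a shift by n+m+2 scaled
   by 2(b-1) on the x's and by 1-2b on the y's, and a further difference E of
   products of G's with D kills the x's; a combination P of D and E thus projects
   onto the x's up to a shift. Let z_j be the image of u (x) x_j under an
   isomorphism onto V(c1,h1) (x) SA'_{a1,b1}. Then E z_j = 0, hence P z_j is a
   multiple of z_{j+T}, and for large T this vector comes from the x's of the
   second factor. Applying D to it gives b = b1, and applying L_p recovers the
   action of L_0 on the second factor alone, hence a = a1 mod Z and h is an
   L_0-weight of V(c1,h1), i.e. h1 - h is a nonnegative half-integer. By symmetry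
   h = h1. The converse is the uniqueness of the simple quotient: a proper
   submodule of M(c,h) is contained in the span of the weights below h. *)

Arguments nspar {K n}.
Arguments nsgact {K n} g.

(** * Induction over spanning sets *)

Definition lin_closed (K : pzRingType) (V : lmodType K) (P : V -> Prop) :=
  P 0 /\ forall a x y, P x -> P y -> P (a *: x + y).

Section LinClosed.
Variables (K : pzRingType) (V : lmodType K) (P : V -> Prop).
Hypothesis lP : lin_closed P.

Lemma lin_closedD x y : P x -> P y -> P (x + y).
Proof. by move=> Px Py; rewrite -[x]scale1r; apply: lP.2. Qed.

Lemma lin_closedZ a x : P x -> P (a *: x).
Proof. by move=> Px; rewrite -[_ *: _]addr0; apply: lP.2 => //; exact: lP.1. Qed.

Lemma lin_closed_sum (I : Type) (s : seq I) (F : I -> V) :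
  (forall i, P (F i)) -> P (\sum_(i <- s) F i).
Proof.
move=> PF; elim: s => [|i s IH]; first by rewrite big_nil; exact: lP.1.
by rewrite big_cons; apply: lin_closedD.
Qed.

End LinClosed.

Lemma lin_closed_pre (K : pzRingType) (V W : lmodType K) (f : {linear V -> W})
    (P : W -> Prop) : lin_closed P -> lin_closed (fun x => P (f x)).
Proof. by move=> [P0 PL]; split=> [|a x y]; rewrite ?linear0 ?linearP //; exact: PL. Qed.

Lemma malg_ind (K : nzRingType) (B : choiceType) (P : {malg K[B]} -> Prop) :
  lin_closed P -> (forall k, P (bas K k)) -> forall x, P x.
Proof.
by move=> lP Pb x; rewrite [x]malg_scaleU; apply: lin_closed_sum => // k; exact: lin_closedZ.
Qed.

Lemma tensor_ind (K : comNzRingType) (V W : lmodType K) (P : tensor V W -> Prop) :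
  lin_closed P -> (forall v w, P (tens v w)) -> forall x, P x.
Proof.
move=> lP Pt; elim/qind => x; move: x.
apply: (malg_ind (P := fun x => P (qpi _ x))); first exact: lin_closed_pre.
by case=> v w; exact: Pt.
Qed.

(** * Products of factors [F - l] and eigenvalues of [F] *)

Section Shifts.
Variables (K : fieldType) (V : lmodType K) (F : {linear V -> V}).

Definition shifts (s : seq K) (x : V) := foldr (fun l y => F y - l *: y) x s.

Lemma shifts_is_linear s : linear (shifts s).
Proof.
elim: s => [|l s IH] a x y //=.
by rewrite IH linearP scalerDr scalerBr opprD addrACA !scalerA mulrC.
Qed.

HB.instance Definition _ s := GRing.isLinear.Build K V V *:%R (shifts s) (shifts_is_linear s).

Lemma shifts_comm s x : shifts s (F x) = F (shifts s x).
Proof. by elim: s => //= l s ->; rewrite linearB [F (_ *: _)]linearZ. Qed.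

Lemma shifts_cat s t x : shifts (s ++ t) x = shifts s (shifts t x).
Proof. by rewrite /shifts foldr_cat. Qed.

(** All factors are polynomials in [F] and therefore commute, so either half of the list may act
    first. *)
Lemma shifts_catC s t x : shifts (s ++ t) x = shifts t (shifts s x).
Proof.
rewrite shifts_cat; elim: s => //= l s ->.
by rewrite [RHS]linearB [X in _ = _ - X]linearZ /= shifts_comm.
Qed.

Lemma shifts_eigen s l x : F x = l *: x -> shifts s x = (\prod_(k <- s) (l - k)) *: x.
Proof.
move=> Fx; elim: s => [|k s /= ->]; first by rewrite big_nil scale1r.
by rewrite big_cons linearZ /= Fx !scalerA -scalerBl mulrBl; congr ((_ - _) *: _); ring.
Qed.

(* A sum of eigenvectors with eigenvalues in [L] is killed by a product of
   factors [F - l] with [l] in [L]; this form avoids direct sum decompositions. *)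
Definition annihilated (L : K -> Prop) (x : V) :=
  exists2 s : seq K, (forall l, l \in s -> L l) & shifts s x = 0.

(** The concatenation of the two lists kills a combination: on each term, the half that annihilates
    it can be made to act first. *)
Lemma annihilated_lin (L : K -> Prop) : lin_closed (annihilated L).
Proof.
split; first by exists [::].
move=> a x y [s sL sx] [t tL ty]; exists (s ++ t).
  by move=> l; rewrite mem_cat => /orP[/sL|/tL].
rewrite linearP /= {1}shifts_catC shifts_cat sx ty.
by rewrite !linear0 addr0.
Qed.

Lemma annihilated_eigen (L : K -> Prop) l x : L l -> F x = l *: x -> annihilated L x.
Proof.
by move=> Ll Fx; exists [:: l] => [k|/=]; rewrite ?inE ?Fx ?subrr // => /eqP->.
Qed.

(** On an eigenvector the product acts as the scalar [\prod (l - k)]; over a field it can vanish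
    only if [l] is one of the [k]. *)
Lemma eigen_annihilated (L : K -> Prop) l x :
  F x = l *: x -> x <> 0 -> annihilated L x -> L l.
Proof.
move=> Fx x0 [s sL]; rewrite (shifts_eigen _ Fx) => /eqP.
rewrite scaler_eq0 => /orP[|/eqP //].
by rewrite prodf_seq_eq0 => /hasP[k ks]; rewrite subr_eq0 => /eqP->; exact: sL.
Qed.

End Shifts.

(** * Highest weight modules *)

Section HighestWeight.
Variable K : numFieldType.

(** The eigenvalue of [g] under ad L_0. With the present signs, modes of positive index raise the
    weight. *)
Definition gdeg (g : nsgen) : K :=
  match g with genL n => n%:~R | genG k => Defs.half K k | genC => 0 end.

Lemma nsgact_swap (V : nsmod K) g g' (v : V) :
  nsgact g (nsgact g' v) = (-1) ^+ (isodd g && isodd g') *: nsgact g' (nsgact g v) +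
    linext (fun k => nsgact k v) (nsbr K g g').
Proof. by rewrite -nsgact_br addrC subrK. Qed.

Lemma nsgact_L0 (V : nsmod K) g (v : V) :
  nsgact (genL 0) (nsgact g v) = nsgact g (nsgact (genL 0) v) + gdeg g *: nsgact g v.
Proof.
rewrite nsgact_swap expr0 scale1r; congr (_ + _).
case: g => [n|k|].
- by rewrite linext_brLL expr0n /= subrr mul0r mulr0 scale0r addr0 subr0 add0r.
- by rewrite linext_brLG mul0r subr0 add0r.
- by rewrite linext_brC // scale0r.
Qed.

Lemma nsgact_C (V : nsmod K) g (v : V) : nsgact genC (nsgact g v) = nsgact g (nsgact genC v).
Proof. by rewrite nsgact_swap linext_brC // expr0 scale1r addr0. Qed.

(** Shared by Verma modules and their simple quotients. Generation by [u] takes the form of an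
    induction principle. *)
Record hwmod (c h : K) (V : nsmod K) (u : V) : Prop := HwMod {
  hw_neq0 : u <> 0;
  hw_bplus : forall g, in_bplus g -> nsgact g u = hwchar c h (nsb K g) *: u;
  hw_ind : forall P : V -> Prop, lin_closed P -> P u ->
    (forall g x, P x -> P (nsgact g x)) -> forall x, P x }.

Section HwTheory.
Variables (c h : K) (V : nsmod K) (u : V).
Hypothesis hV : hwmod c h u.

Lemma hwcharE g : hwchar c h (nsb K g) = h * (g == genL 0)%:R + c * (g == genC)%:R.
Proof. by rewrite /hwchar !mcoeff_bas. Qed.

Lemma hw_L0 : nsgact (genL 0) u = h *: u.
Proof. by rewrite (hw_bplus hV) // hwcharE eqxx mulr1 mulr0 addr0. Qed.

Lemma hw_posL n : 0 < n -> nsgact (genL n) u = 0.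
Proof.
move=> n0; rewrite (hw_bplus hV) /= ?ltW // hwcharE.
have /negbTE-> : genL n != genL 0 by apply/eqP => -[] n00; rewrite n00 ltxx in n0.
by rewrite !mulr0 addr0 scale0r.
Qed.

Lemma hw_posG n : 0 <= n -> nsgact (genG n) u = 0.
Proof. by move=> n0; rewrite (hw_bplus hV) // hwcharE !mulr0 addr0 scale0r. Qed.

Lemma hw_C (x : V) : nsgact genC x = c *: x.
Proof.
move: x; apply: (hw_ind hV).
- split=> [|a x y Px Py]; rewrite ?linear0 ?scaler0 // linearP /= Px Py scalerDr !scalerA.
  by rewrite mulrC.
- by rewrite (hw_bplus hV) // hwcharE eqxx mulr1 mulr0 add0r.
- by move=> g x Px; rewrite nsgact_C Px linearZ.
Qed.

(** Moving a mode of large degree past a generator leaves the same mode and a bracket, which is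
    again a mode of large degree. *)
Lemma hw_nilp (x : V) : exists N : int, forall n, N <= n ->
  nsgact (genL n) x = 0 /\ nsgact (genG n) x = 0.
Proof.
move: x; apply: (hw_ind hV).
- split=> [|a x y [N Nx] [M My]]; first by exists 0 => n _; rewrite !linear0.
  exists (Num.max N M) => n; rewrite ge_max => /andP[/Nx[x1 x2] /My[y1 y2]].
  by rewrite !linearP /= x1 x2 y1 y2 scaler0 addr0.
- by exists 1 => n n1; rewrite hw_posL ?hw_posG //; lia.
move=> g x [N Nx]; case: g => [m|m|].
(* [N] kills [x] itself, [N - m] makes the mode in the bracket kill [x], and [1 - m] keeps [n + m]
   positive, so that no central term appears. *)
- exists (Num.max N (Num.max (N - m) (1 - m))) => n nN.
  have [x1 x2] : nsgact (genL n) x = 0 /\ nsgact (genG n) x = 0 by apply: Nx; lia.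
  have [y1 y2] : nsgact (genL (n + m)) x = 0 /\ nsgact (genG (m + n)) x = 0.
    by split; [case: (Nx (n + m)) => //; lia | case: (Nx (m + n)) => //; lia].
  have nm0 : (n + m == 0) = false by lia.
  split; rewrite nsgact_swap ?x1 ?x2 !linear0 add0r.
    by rewrite linext_brLL y1 nm0 mul0r scale0r addr0 scaler0.
  by rewrite linext_brGL y2 scaler0.
- exists (Num.max N (Num.max (N - m) (- m))) => n nN.
  have [x1 x2] : nsgact (genL n) x = 0 /\ nsgact (genG n) x = 0 by apply: Nx; lia.
  have [y1 y2] : nsgact (genL (n + m + 1)) x = 0 /\ nsgact (genG (n + m)) x = 0.
    by split; [case: (Nx (n + m + 1)) => //; lia | case: (Nx (n + m)) => //; lia].
  have nm0 : (n + m + 1 == 0) = false by lia.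
  split; rewrite nsgact_swap ?x1 ?x2 !linear0 add0r.
    by rewrite linext_brLG y2 scaler0.
  by rewrite linext_brGG y1 nm0 mulr0 mul0r scale0r subr0 scaler0.
- exists N => n /Nx[x1 x2].
  by rewrite -!nsgact_C x1 x2 !linear0.
Qed.

Definition wordact (s : seq nsgen) : V := foldr (fun g x => nsgact g x) u s.

(** The unordered half of PBW: the span [inS] of the words in generators outside b+ is stable under
    every [g]. Such a [g] lengthens the word; any other is swapped past the first letter, and the
    bracket is a combination of single generators acting on a shorter word. *)
Lemma hw_word_ind (P : V -> Prop) : lin_closed P ->
  (forall s, all (predC in_bplus) s -> P (wordact s)) -> forall x, P x.
Proof.
pose inS x := forall P : V -> Prop, lin_closed P ->
  (forall s, all (predC in_bplus) s -> P (wordact s)) -> P x.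
have lS : lin_closed inS.
  split=> [Q lQ _|a x y Sx Sy Q lQ Qw]; first exact: lQ.1.
  by apply: lQ.2; [exact: Sx|exact: Sy].
have Sact g : (forall s, all (predC in_bplus) s -> inS (nsgact g (wordact s))) ->
    forall x, inS x -> inS (nsgact g x).
  move=> gw x Sx; apply: (Sx (fun y => inS (nsgact g y))) => //.
  exact: (lin_closed_pre (nsgact g) lS).
have Sneg g : ~~ in_bplus g -> forall x, inS x -> inS (nsgact g x).
  move=> gn; apply: Sact => s sn Q lQ Qw; apply: (Qw (g :: s)).
  by rewrite /= gn.
have Sword s : all (predC in_bplus) s -> forall g, inS (nsgact g (wordact s)).
  elim: s => [_ g|g' s IH /= /andP[gn sn] g].
    have [gb|gn] := boolP (in_bplus g).
      rewrite (hw_bplus hV) //; apply: (lin_closedZ lS) => Q _ Qw; exact: (Qw [::]).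
    by apply: Sneg => // Q _ Qw; exact: (Qw [::]).
  rewrite nsgact_swap; apply: (lin_closedD lS).
    by apply: (lin_closedZ lS); apply: Sneg => //; exact: IH.
  rewrite /= linext_funE; apply: (lin_closed_sum lS) => k; apply: (lin_closedZ lS); exact: IH.
move=> lP Pw x; suff: inS x by apply.
move: x; apply: (hw_ind hV) => //; first by move=> Q _ Qw; exact: (Qw [::]).
by move=> g; apply: Sact => s sn; exact: Sword.
Qed.

Lemma gdeg_neg g : ~~ in_bplus g -> exists n : nat, gdeg g = - (n.+1%:R / 2).
Proof.
case: g => [n|k|] //=; rewrite -ltNge.
  case: n => // n _; exists n.*2.+1; rewrite NegzE mulrNz; congr (- _).
  by rewrite -doubleS -muln2 natrM mulfK // pnatr_eq0.
case: k => // k _; exists k.*2; rewrite /Defs.half NegzE mulrNz -pmulrn.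
by rewrite -[in LHS]natr1 -[in RHS]natr1 -muln2 natrM; field.
Qed.

Lemma word_weight s : all (predC in_bplus) s -> exists2 n : nat,
  (s != [::] -> (0 < n)%N) & nsgact (genL 0) (wordact s) = (h - n%:R / 2) *: wordact s.
Proof.
elim: s => [_|g s IH /= /andP[/gdeg_neg[m dg] /IH[n _ Ln]]].
  by exists 0%N => //; rewrite mul0r subr0 hw_L0.
exists (m.+1 + n)%N => //; rewrite nsgact_L0 Ln linearZ /= dg -scalerDl.
by congr (_ *: _); rewrite natrD; field.
Qed.

Lemma hw_weights (x : V) :
  annihilated (@nsgact K V (genL 0)) (fun l => exists n : nat, l = h - n%:R / 2) x.
Proof.
move: x; apply: hw_word_ind; first exact: annihilated_lin.
by move=> s /word_weight[n _]; apply: annihilated_eigen; exists n.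
Qed.

(** Only the empty word has weight [h]: the top weight space is the line of [u]. *)
Lemma hw_split (x : V) : exists k,
  annihilated (@nsgact K V (genL 0)) (fun l => exists n : nat, l = h - n.+1%:R / 2) (x - k *: u).
Proof.
move: x; apply: hw_word_ind.
  split=> [|a x y [k kx] [l ly]].
    by exists 0; rewrite scale0r subr0; case: (annihilated_lin (@nsgact K V (genL 0))
      (fun l => exists n : nat, l = h - n.+1%:R / 2)).
  exists (a * k + l); have -> : a *: x + y - (a * k + l) *: u = a *: (x - k *: u) + (y - l *: u).
    by rewrite scalerBr scalerA scalerDl opprD addrACA.
  by apply: (annihilated_lin _ _).2.
move=> [|g s] sn.
  exists 1; rewrite scale1r subrr; exact: (annihilated_lin _ _).1.
exists 0; rewrite scale0r subr0.
have [[/(_ isT)//|n _ Ls]] := word_weight sn.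
by apply: annihilated_eigen Ls; exists n.
Qed.

Lemma hw_top_notin k :
  annihilated (@nsgact K V (genL 0)) (fun l => exists n : nat, l = h - n.+1%:R / 2) (k *: u) ->
  k = 0.
Proof.
move=> ku; have [->//|k0] := eqVneq k 0; exfalso.
have : exists n : nat, h = h - n.+1%:R / 2.
  apply: (eigen_annihilated (F := @nsgact K V (genL 0)) (x := k *: u)) ku.
    by rewrite linearZ /= hw_L0 !scalerA mulrC.
  by move/eqP; rewrite scaler_eq0 (negbTE k0) => /eqP; exact: (hw_neq0 hV).
move=> [n /eqP]; rewrite -subr_eq0 opprD opprK addNKr => /eqP n0.
have : (n.+1%:R : K) = 0 by rewrite -[LHS](@mulfVK _ 2) ?n0 ?mul0r // pnatr_eq0.
by move/eqP; rewrite pnatr_eq0.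
Qed.

(** Write [x] as [k *: u] plus lower weights. A product of shifts killing the lower part preserves
    [N] and multiplies [u] by a nonzero scalar, every factor being some [n.+1%:R / 2]. So [k <> 0]
    would put [u] into [N]. *)
Lemma hw_proper (N : submodClosed V) : (forall x v, v \in N -> nsact x v \in N) ->
  u \notin N -> forall x, x \in N ->
  annihilated (@nsgact K V (genL 0)) (fun l => exists n : nat, l = h - n.+1%:R / 2) x.
Proof.
move=> sN uN x xN; have [k ann] := hw_split x.
suff k0 : k = 0 by rewrite k0 scale0r subr0 in ann.
have [->//|k0] := eqVneq k 0; exfalso.
case: ann => s sL /eqP; rewrite linearB linearZ /= subr_eq0 => /eqP e.
have Ns : shifts (@nsgact K V (genL 0)) s x \in N.
  elim: s {sL e} => //= l s IH; rewrite -scaleNr rpredD ?rpredZ //.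
  by rewrite -nsact_nsb; exact: sN.
move: Ns; rewrite e (shifts_eigen _ hw_L0) scalerA => Ns.
have p0 : k * \prod_(l <- s) (h - l) != 0.
  rewrite mulf_neq0 // prodf_seq_neq0; apply/allP => l /sL[n ->].
  by rewrite opprB addrCA subrr addr0 mulf_neq0 // ?invr_eq0 pnatr_eq0.
by move: uN; rewrite -[u](scalerK p0) rpredZ.
Qed.

End HwTheory.
End HighestWeight.

(** * Simple quotients of Verma modules *)

Lemma tens_scaler (K : comNzRingType) (V W : lmodType K) (v : V) a (w : W) :
  tens v (a *: w) = a *: tens v w.
Proof.
have t0 : tens v (0 : W) = 0.
  have := tens_linearr v 1 (0 : W) 0; rewrite !scale1r addr0 => /esym/eqP.
  by rewrite -subr_eq0 addrK => /eqP.
by have := tens_linearr v a w 0; rewrite !addr0 t0 addr0.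
Qed.

Section SimpleQuotient.
Variables (K : numFieldType) (c h : K).

Let vac : verma c h := vtens c h 1 1.

(** The scalar factor is pulled out of the tensor. U(NS) is a quotient of the free algebra, so
    induction on words then suffices. *)
Lemma verma_ind (P : verma c h -> Prop) : lin_closed P -> P vac ->
  (forall g x, P x -> P (nsgact g x)) -> forall x, P x.
Proof.
move=> lP P1 Pg; elim/qind => t; move: t.
apply: (tensor_ind (P := fun t => P (qpi _ t))); first exact: lin_closed_pre.
move=> x z; rewrite -/(vtens c h x z).
have -> : vtens c h x z = z *: vtens c h x 1.
  by rewrite -[RHS]linearZ -tens_scaler /GRing.scale /= mulr1.
apply: (lin_closedZ lP); elim/uind: x => p; move: p.
pose v1 (p : {malg K[{fmonom nsgen}]}) : verma c h := vtens c h (upi p) 1.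
have v1l : linear v1.
  by move=> a x y; rewrite /v1 upi_is_linear vtens_linear.
pose v1L : {linear {malg K[{fmonom nsgen}]} -> verma c h} :=
  HB.pack v1 (GRing.isLinear.Build K _ _ *:%R v1 v1l).
apply: (malg_ind (P := fun p => P (v1L p))); first exact: lin_closed_pre.
case; elim=> [|g s IH].
  have -> : bas K (FMonom [::]) = 1 :> {malg K[{fmonom nsgen}]}.
    by rewrite basE -fmE.
  exact: P1.
have -> : bas K (FMonom (g :: s)) = fgen K g * bas K (FMonom s).
  rewrite /fgen basM; congr bas.
  by apply/eqP; rewrite fmP fmM fmU.
have : P (nsgact g (v1 (bas K (FMonom s)))) by exact: Pg.
have -> : nsgact g (v1 (bas K (FMonom s))) = vtens c h (ugen K g * upi (bas K (FMonom s))) 1.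
  exact: verma_actE.
by rewrite /ugen -upiM.
Qed.

Lemma verma_bplus g : in_bplus g -> nsgact g vac = hwchar c h (nsb K g) *: vac.
Proof.
move=> gb; rewrite [LHS]verma_actE mulr1 -[ugen K g]mul1r -(uincl_nsb K g).
rewrite vtens_rel; last by apply: mem_span; exists g.
by rewrite /vtens /vac -linearZ tens_scaler.
Qed.

Section OneQuotient.
Variable Q : simple_quotient (verma c h).

(** If the image of [vac] vanished, generation would make the whole simple quotient zero. *)
Lemma sq_hwmod : hwmod c h (qpi (sq_ker Q) vac : sq_mod Q).
Proof.
have indQ (P : sq_mod Q -> Prop) : lin_closed P -> P (qpi (sq_ker Q) vac) ->
    (forall g x, P x -> P (nsgact g x)) -> forall x, P x.
  move=> lP P1 Pg; elim/qind; apply: verma_ind => //; first exact: lin_closed_pre.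
  by move=> g x /(Pg g); rewrite [nsgact g _]quot_actE.
split=> // [v0|g gb].
  have [[v /eqP v1] _] := sq_simple Q; apply: v1; move: v.
  apply: indQ => //; first by split=> // a x y -> ->; rewrite scaler0 addr0.
  by move=> g x ->; rewrite linear0.
by rewrite [nsgact g _]quot_actE -linearZ; congr (qpi _ _); exact: verma_bplus.
Qed.

Lemma sq_ker_stable x v : v \in sq_ker Q -> nsact x v \in sq_ker Q.
Proof. exact: (sq_kerP Q).2. Qed.

Lemma sq_vac_notin : vac \notin sq_ker Q.
Proof. by rewrite -qpi_eq0; apply/eqP; exact: hw_neq0 sq_hwmod. Qed.

End OneQuotient.

(** Nonvanishing of [vac] is read off from the given quotient [Q], whose kernel misses it; this
    replaces an appeal to PBW. *)
Lemma verma_hwmod (Q : simple_quotient (verma c h)) : hwmod c h vac.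
Proof.
split=> [v0||]; [|exact: verma_bplus|exact: verma_ind].
by have := sq_vac_notin Q; rewrite v0 rpred0.
Qed.

(** The image of one kernel in the other simple quotient is a submodule. If it is zero, the
    inclusion holds. If it is everything, [vac] is a sum of elements of the two kernels, hence of
    vectors of weights below [h], which is impossible. *)
Lemma sq_ker_sub (Q Q1 : simple_quotient (verma c h)) v :
  v \in sq_ker Q1 -> v \in sq_ker Q.
Proof.
have hwM := verma_hwmod Q.
pose S : set (sq_mod Q) := fun y => exists2 w, w \in sq_ker Q1 & y = qpi (sq_ker Q) w.
have Sl : lin_closed S.
  split=> [|a x y [w wN ->] [w' wN' ->]].
    by exists 0; rewrite ?rpred0 ?linear0.
  by exists (a *: w + w'); rewrite ?rpredD ?rpredZ ?linearP.
pose N : {pred sq_mod Q} := fun y => `[< S y >].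
have NP : subsemimod_closed N.
  split; first split.
  - by apply/asboolP; exact: Sl.1.
  - by move=> x y /asboolP xS /asboolP yS; apply/asboolP; exact: lin_closedD.
  - by move=> a x /asboolP xS; apply/asboolP; exact: lin_closedZ.
pose N' : submodClosed (sq_mod Q) := HB.pack N (GRing.isSubmodClosed.Build K _ N NP).
have actq x w : nsact x (qpi (sq_ker Q) w : sq_mod Q) = qpi (sq_ker Q) (nsact x w).
  rewrite /nsact linear_linext; last exact: linearP.
  by apply: eq_linext => g; exact: quot_actE.
have [|N0|Nfull vN] := (sq_simple Q).2 N'.
- split=> [y|x y] /asboolP[w wN ->]; apply/asboolP.
    exists (nspar w); first exact: (sq_kerP Q1).1.
    exact: quot_parE.
  by exists (nsact x w); [exact: sq_ker_stable|rewrite actq].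
- move=> vN; rewrite -qpi_eq0; apply/eqP; apply: N0.
  by apply/asboolP; exists v.
exfalso; have /asboolP[w wN /qpiP wv] := Nfull (qpi (sq_ker Q) vac).
have ann1 := hw_proper hwM (@sq_ker_stable Q) (sq_vac_notin Q) wv.
have ann2 := hw_proper hwM (@sq_ker_stable Q1) (sq_vac_notin Q1) wN.
have := lin_closedD (annihilated_lin _ _) ann1 ann2.
rewrite subrK -[vac]scale1r => /(hw_top_notin hwM)/eqP.
by rewrite oner_eq0.
Qed.

Lemma sq_qpi_subproof (Q Q1 : simple_quotient (verma c h)) x :
  x \in sq_ker Q -> qpi (sq_ker Q1) x = 0.
Proof. by move=> /(sq_ker_sub Q1) xN; apply/eqP; rewrite qpi_eq0. Qed.

Definition sq_map (Q Q1 : simple_quotient (verma c h)) : {linear sq_mod Q -> sq_mod Q1} :=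
  qlift (@sq_qpi_subproof Q Q1).

Lemma sq_mapE Q Q1 x : sq_map Q Q1 (qpi _ x) = qpi _ x.
Proof. exact: qliftE. Qed.

End SimpleQuotient.

(** * Isomorphisms of the first tensor factor *)

Section TensorIso.
Variables (K : numFieldType) (V V1 A : nsmod K).
Variables (f : {linear V -> V1}) (g : {linear V1 -> V}).
Hypotheses (fK : cancel f g) (gK : cancel g f).
Hypothesis fpar : forall v, f (nspar v) = nspar (f v).
Hypothesis fact : forall e v, f (nsgact e v) = nsgact e (f v).

Lemma tensor_nsiso : nsiso (tensor_mod V A) (tensor_mod V1 A).
Proof.
have fl (U U1 : nsmod K) (p : {linear U -> U1}) (w : A) :
    linear (fun v => tens (p v) w : tensor U1 A).
  by move=> a x y; rewrite linearP tens_linearl.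
have fr (U U1 : nsmod K) (p : {linear U -> U1}) (v : U) :
    linear (fun w => tens (p v) w : tensor U1 A) by exact: tens_linearr.
pose F : {linear tensor_mod V A -> tensor_mod V1 A} := tlift (fl _ _ f) (fr _ _ f).
pose G : {linear tensor_mod V1 A -> tensor_mod V A} := tlift (fl _ _ g) (fr _ _ g).
have FE v w : F (tens v w) = tens (f v) w by exact: tliftE.
have GE v w : G (tens v w) = tens (g v) w by exact: tliftE.
have eq_lin (X Y : lmodType K) (p q : {linear X -> Y}) : lin_closed (fun x => p x = q x).
  by split=> [|a x y px py]; rewrite ?linear0 // !linearP px py.
exists F; split.
  exists G.
    apply: (@linear_tens _ _ _ _ (G \o F) idfun) => // [a x y|v w]; first exact: linearP.
    by rewrite /= FE GE fK.
  apply: (@linear_tens _ _ _ _ (F \o G) idfun) => // [a x y|v w]; first exact: linearP.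
  by rewrite /= GE FE gK.
move=> x v; rewrite /nsact linear_linext; last exact: linearP.
apply: eq_linext => e /=; move: v.
apply: (tensor_ind (P := fun v => F (tens_act V A e v) = tens_act V1 A e (F v))).
  exact: (eq_lin _ _ (F \o tens_act V A e) (tens_act V1 A e \o F)).
move=> v w; rewrite FE !tens_actE linearD !FE fact.
(* Compatibility with parity enters here: an odd element acts on the second factor with the sign of
   the first. *)
by case: (isodd e) => //=; rewrite fpar.
Qed.

End TensorIso.

Lemma sq_nsiso (K : numFieldType) (c h : K) (Q Q1 : simple_quotient (verma c h))
  (A : nsmod K) : nsiso (tensor_mod (sq_mod Q) A) (tensor_mod (sq_mod Q1) A).
Proof.
apply: (@tensor_nsiso K (sq_mod Q) (sq_mod Q1) A (sq_map Q Q1) (sq_map Q1 Q)).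
- by elim/qind => x; rewrite !sq_mapE.
- by elim/qind => x; rewrite !sq_mapE.
- by elim/qind => x; rewrite [nspar _]quot_parE !sq_mapE [RHS]quot_parE.
- by move=> e; elim/qind => x; rewrite [nsgact _ _]quot_actE !sq_mapE [RHS]quot_actE.
Qed.

(** * Differences of products of odd modes *)

Lemma eq_lin_closed (K : pzRingType) (V W : lmodType K) (F G : V -> W) :
  linear F -> linear G -> lin_closed (fun x => F x = G x).
Proof.
move=> lF lG; split=> [|a x y Fx Fy]; last by rewrite lF lG Fx Fy.
have lin0 (H : V -> W) : linear H -> H 0 = 0.
  by move=> /(_ (-1) 0 0); rewrite scaler0 addr0 scaleN1r addNr.
by rewrite !lin0.
Qed.

Section GOperators.
Variables (K : numFieldType) (M : nsmod K).

(* Modes are shifted by 1/2, so [opD n m] has degree n+m+2, [opE k i n m] has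
   degree k+i+n+m+4, and both terms of [opP s k T] have degree T. *)
Definition opD (n m : int) (v : M) : M :=
  nsgact (genG (n + 1)) (nsgact (genG m) v) - nsgact (genG n) (nsgact (genG (m + 1)) v).

Definition opE (k i n m : int) (v : M) : M :=
  nsgact (genG k) (nsgact (genG (i + 1)) (opD n m v))
  - nsgact (genG k) (nsgact (genG i) (opD n (m + 1) v)).

Definition opP (s : K) (k T : int) (v : M) : M :=
  s *: opD k (T - k - 2) v - opE k k k (T - 3 * k - 4) v.

Lemma nsgact2_linear g g' : linear (fun v : M => nsgact g (nsgact g' v)).
Proof. by move=> a x y; rewrite !linearP. Qed.

Lemma nsgact2Z g g' a (v : M) : nsgact g (nsgact g' (a *: v)) = a *: nsgact g (nsgact g' v).
Proof. by rewrite !linearZ. Qed.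

Lemma opDZ n m a (v : M) : opD n m (a *: v) = a *: opD n m v.
Proof. by rewrite /opD !nsgact2Z scalerBr. Qed.

Lemma opD_linear n m : linear (opD n m).
Proof. by move=> a x y; rewrite /opD !nsgact2_linear opprD addrACA -scalerBr. Qed.

Lemma opE_linear k i n m : linear (opE k i n m).
Proof.
by move=> a x y; rewrite /opE !opD_linear !nsgact2_linear opprD addrACA -scalerBr.
Qed.

Lemma opP_linear s k T : linear (opP s k T).
Proof.
move=> a x y; rewrite /opP opD_linear opE_linear scalerDr [- (_ *: _ + _)]opprD addrACA.
by rewrite scalerA [s * a]mulrC -scalerA -scalerBr.
Qed.

End GOperators.

Section GOperatorsMorphism.
Variables (K : numFieldType) (M M1 : nsmod K) (f : {linear M -> M1}).
Hypothesis fact : forall g v, f (nsgact g v) = nsgact g (f v).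

Lemma opD_morph n m v : f (opD n m v) = opD n m (f v).
Proof. by rewrite /opD linearB !fact. Qed.

Lemma opE_morph k i n m v : f (opE k i n m v) = opE k i n m (f v).
Proof. by rewrite /opE linearB !fact !opD_morph. Qed.

End GOperatorsMorphism.

(** * The modules SA and SA' and the action of D, E and P *)

Section SAlike.
Variables (K : numFieldType).

(** Treats SA and its quotient together. In the quotient one [Y j] is zero, so the families are only
    required to span; the functionals [xi] witness that each [X j] is nonzero. *)
Record samod (a b : K) (A : nsmod K) (X Y : int -> A) : Prop := SAMod {
  sam_Lx : forall i j, nsgact (genL i) (X j) = (a + j%:~R + i%:~R * b) *: X (i + j);
  sam_Ly : forall i j, nsgact (genL i) (Y j) =
    (a + 2^-1 + j%:~R + i%:~R * (b - 2^-1)) *: Y (i + j);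
  sam_Gx : forall i j, nsgact (genG i) (X j) = Y (i + j);
  sam_Gy : forall i j, nsgact (genG i) (Y j) =
    (a + 2^-1 + j%:~R + 2 * (2^-1 + i%:~R) * (b - 2^-1)) *: X (1 + i + j);
  sam_C : forall v : A, nsgact genC v = 0;
  sam_ind : forall P : A -> Prop, lin_closed P -> (forall i, P (X i)) ->
    (forall i, P (Y i)) -> forall v, P v;
  sam_coef : forall j, exists xi : {linear A -> K^o}, xi (X j) <> 0 }.

Section Theory.
Variables (a b : K) (A : nsmod K) (X Y : int -> A).
Hypothesis hA : samod a b X Y.

Local Notation al := (2 * (b - 1)).
Local Notation be := (1 - 2 * b).

Lemma sam_GGx k i j : nsgact (genG k) (nsgact (genG i) (X j)) =
  (a + 2^-1 + (i + j)%:~R + 2 * (2^-1 + k%:~R) * (b - 2^-1)) *: X (k + i + j + 1).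
Proof. by rewrite (sam_Gx hA) (sam_Gy hA); congr (_ *: X _); ring. Qed.

Lemma sam_GGy k i j : nsgact (genG k) (nsgact (genG i) (Y j)) =
  (a + 2^-1 + j%:~R + 2 * (2^-1 + i%:~R) * (b - 2^-1)) *: Y (k + i + j + 1).
Proof. by rewrite (sam_Gy hA) linearZ /= (sam_Gx hA); congr (_ *: Y _); ring. Qed.

Lemma opD_X n m j : opD n m (X j) = al *: X (n + m + 2 + j).
Proof.
rewrite /opD !sam_GGx.
have -> : n + 1 + m + j + 1 = n + m + 2 + j by ring.
have -> : n + (m + 1) + j + 1 = n + m + 2 + j by ring.
by rewrite -scalerBl; congr (_ *: _); rewrite !intrD; field.
Qed.

Lemma opD_Y n m j : opD n m (Y j) = be *: Y (n + m + 2 + j).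
Proof.
rewrite /opD !sam_GGy.
have -> : n + 1 + m + j + 1 = n + m + 2 + j by ring.
have -> : n + (m + 1) + j + 1 = n + m + 2 + j by ring.
by rewrite -scalerBl; congr (_ *: _); rewrite !intrD; field.
Qed.

(** On the x's, D does not see how its degree is split, and the coefficient in [sam_GGx] depends on
    [i] and [j] only through [i + j]; hence the two terms agree. *)
Lemma opE_X k i n m j : opE k i n m (X j) = 0.
Proof.
rewrite /opE !opD_X !nsgact2Z !sam_GGx.
have -> : k + i + (n + (m + 1) + 2 + j) + 1 = k + (i + 1) + (n + m + 2 + j) + 1 by ring.
rewrite -scalerBr -scalerBl; set e := (e in _ *: (e *: _)).
have -> : e = 0 by rewrite /e !intrD; ring.
by rewrite scale0r scaler0.
Qed.

Lemma opE_Y k i n m j : opE k i n m (Y j) = (al * be) *: Y (k + i + n + m + 4 + j).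
Proof.
rewrite /opE !opD_Y !nsgact2Z !sam_GGy.
have -> : k + i + (n + (m + 1) + 2 + j) + 1 = k + i + n + m + 4 + j by ring.
have -> : k + (i + 1) + (n + m + 2 + j) + 1 = k + i + n + m + 4 + j by ring.
rewrite -scalerBr -scalerBl scalerA; congr (_ *: _).
by rewrite !intrD; field.
Qed.

Lemma opP_X k T j : opP al k T (X j) = (al ^+ 2) *: X (T + j).
Proof.
rewrite /opP opE_X subr0 opD_X scalerA; congr (_ *: X _); ring.
Qed.

(** The factor [al] in front of D matches the coefficient [al * be] of E. *)
Lemma opP_Y k T j : opP al k T (Y j) = 0.
Proof.
rewrite /opP opE_Y opD_Y scalerA; apply/eqP; rewrite subr_eq0; apply/eqP.
by congr (_ *: Y _); ring.
Qed.

(** P lands in the span of the x's, where D is [al] times a shift. The splittings [k] and [l] are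
    free since P depends on them only as an expression, not as a map on [A]. *)
Lemma opD_opP n m k l T (v : A) :
  opD n m (opP al k T v) = al *: opP al l (n + m + 2 + T) v.
Proof.
move: v; apply: (sam_ind hA) => [|i|i].
- apply: eq_lin_closed => r x y; first by rewrite opP_linear opD_linear.
  by rewrite opP_linear scalerDr !scalerA mulrC.
- rewrite !opP_X opDZ opD_X !scalerA; congr (_ *: X _); ring.
- have Z : opD n m (0 : A) = 0 by rewrite -(scale0r (0 : A)) opDZ !scale0r.
  by rewrite !opP_Y Z scaler0.
Qed.

(** On an x, L_p and L_0 after a shift by [p] have coefficients differing by [p * (b - 1)]. This
    expresses L_0 on the second factor through a mode of positive degree. *)
Lemma L_opP p k l T (v : A) : nsgact (genL p) (opP al k T v) =
  nsgact (genL 0) (opP al l (p + T) v) + (p%:~R * (b - 1)) *: opP al l (p + T) v.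
Proof.
move: v; apply: (sam_ind hA) => [|i|i].
- apply: eq_lin_closed => r x y; rewrite opP_linear [nsgact _ _]linearP //.
  by rewrite /= [in LHS]scalerDr addrACA [in RHS]scalerDr !scalerA [r * _]mulrC.
- rewrite !opP_X !linearZ /= !(sam_Lx hA) add0r mul0r addr0 !scalerA -scalerDl.
  by rewrite addrA; congr (_ *: _); rewrite !intrD; ring.
- by rewrite !opP_Y !linear0 addr0.
Qed.

End Theory.

Lemma SA_samod a b : samod a b (A := SA a b) (@sa_x K) (@sa_y K).
Proof.
split; rewrite /=.
- exact: sa_Lx.
- exact: sa_Ly.
- exact: sa_Gx.
- exact: sa_Gy.
- apply: linear_sa => [||i|i]; rewrite ?sa_E //; first exact: linearP.
  by move=> r x y; rewrite scaler0 addr0.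
- by move=> P lP Px Py; apply: malg_ind => // -[].
move=> j; pose f (e : int + int) : K^o := (e == inl j)%:R.
by exists (linext f); rewrite linextE /f eqxx; apply/eqP; exact: oner_neq0.
Qed.

Lemma SA'_samod a b : exists X Y : int -> SA' a b, samod a b X Y.
Proof.
rewrite /SA'; case: ifP => [/andP[/eqP-> /eqP->]|_]; last first.
  by exists (@sa_x K), (@sa_y K); exact: SA_samod.
have [Lx Ly Gx Gy Cv ind coef] := SA_samod (2^-1) (2^-1).
pose q := qpi (sa_line K).
exists (fun i => q (sa_x K i)), (fun i => q (sa_y K i)); split.
- by move=> i j; rewrite [LHS]quot_actE Lx -linearZ.
- by move=> i j; rewrite [LHS]quot_actE Ly -linearZ.
- by move=> i j; rewrite [LHS]quot_actE Gx.
- by move=> i j; rewrite [LHS]quot_actE Gy -linearZ.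
- by elim/qind => v; rewrite [LHS]quot_actE Cv linear0.
- by move=> P lP Px Py; elim/qind; apply: ind => //; exact: lin_closed_pre.
move=> j; pose f (e : int + int) : K^o := (e == inl j)%:R.
have fN x : x \in sa_line K -> linext f x = 0.
  by apply: span_eq0 => [|_ ->]; [exact: linearP|rewrite linextE].
exists (qlift fN); rewrite qliftE linextE /f eqxx; apply/eqP; exact: oner_neq0.
Qed.

End SAlike.

(** * Tensor products *)

Section TensorSums.
Variables (K : numFieldType) (V A : nsmod K).
Implicit Types (s : seq (V * A)) (F : A -> A).

Lemma tens0l (w : A) : tens 0 w = 0 :> tensor V A.
Proof. by rewrite -[0](scale0r (0 : V)) tensZl scale0r. Qed.

Lemma tens0r (v : V) : tens v 0 = 0 :> tensor V A.
Proof. by rewrite -[0](scale0r (0 : A)) tensZr scale0r. Qed.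

Definition tsum s F : tensor_mod V A := \sum_(p <- s) tens p.1 (F p.2).

Lemma eq_tsum s F F' : F =1 F' -> tsum s F = tsum s F'.
Proof. by move=> FF; apply: eq_bigr => p _; rewrite FF. Qed.

Lemma tsumB s F F' : tsum s (fun w => F w - F' w) = tsum s F - tsum s F'.
Proof.
rewrite /tsum -sumrB; apply: eq_bigr => p _.
by rewrite -[F' p.2]scale1r tensBZr !scale1r.
Qed.

Lemma tsumD s F F' : tsum s (fun w => F w + F' w) = tsum s F + tsum s F'.
Proof. by rewrite /tsum -big_split; apply: eq_bigr => p _; rewrite tensDr. Qed.

Lemma tsumZ s k F : tsum s (fun w => k *: F w) = k *: tsum s F.
Proof. by rewrite /tsum scaler_sumr; apply: eq_bigr => p _; rewrite tensZr. Qed.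

Lemma tsum_exists (z : tensor_mod V A) : exists s, z = tsum s id.
Proof.
move: z; apply: tensor_ind => [|v w]; last by exists [:: (v, w)]; rewrite /tsum big_seq1.
split=> [|k x y [s ->] [t ->]]; first by exists [::]; rewrite /tsum big_nil.
exists ([seq (k *: p.1, p.2) | p <- s] ++ t).
rewrite /tsum big_cat big_map scaler_sumr; congr (_ + _).
by apply: eq_bigr => p _; rewrite tensZl.
Qed.

Definition nilfrom (N : int) s := forall p, p \in s -> forall n, N <= n ->
  nsgact (genL n) p.1 = 0 /\ nsgact (genG n) p.1 = 0.

Lemma nilfrom_exists s :
  (forall v : V, exists N : int, forall n, N <= n ->
    nsgact (genL n) v = 0 /\ nsgact (genG n) v = 0) ->
  exists2 N : int, 1 <= N & nilfrom N s.
Proof.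
move=> nil; elim: s => [|p s [N N1 Ns]]; first by exists 1.
have [M Mp] := nil p.1; exists (Num.max N M); first by lia.
move=> q; rewrite inE => /orP[/eqP->|qs] n nN; [apply: Mp|apply: Ns] => //; lia.
Qed.

Section Nilfrom.
Variables (N : int) (s : seq (V * A)).
Hypothesis Ns : nilfrom N s.

Lemma tsum_L n F : N <= n ->
  nsgact (genL n) (tsum s F) = tsum s (fun w => nsgact (genL n) (F w)).
Proof.
move=> nN; rewrite /tsum linear_sum big_seq [RHS]big_seq; apply: eq_bigr => p ps.
rewrite [LHS]tens_actE; have [-> _] := Ns ps nN.
by rewrite tens0l add0r.
Qed.

(** The first odd mode applies the parity operator to the first component and the second undoes it,
    so pairs of odd modes act on the second factor without sign. *)
Lemma tsum_GG k i F : N <= k -> N <= i ->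
  nsgact (genG k) (nsgact (genG i) (tsum s F)) =
  tsum s (fun w => nsgact (genG k) (nsgact (genG i) (F w))).
Proof.
move=> kN iN; rewrite /tsum !linear_sum big_seq [RHS]big_seq; apply: eq_bigr => p ps.
have [_ pk] := Ns ps kN; have [_ pi] := Ns ps iN.
have -> : nsgact (genG i) (tens p.1 (F p.2) : tensor_mod V A) =
    tens (nspar p.1) (nsgact (genG i) (F p.2)).
  by rewrite [LHS]tens_actE pi tens0l add0r.
rewrite [LHS]tens_actE /= nsparK.
have -> : nsgact (genG k) (nspar p.1) = 0.
  have := nspar_gact (genG k) p.1; rewrite pk linear0 /= expr1 scaleN1r => /esym/eqP.
  by rewrite oppr_eq0 => /eqP.
by rewrite tens0l add0r.
Qed.

Lemma tsum_opD n m F : N <= n -> N <= m ->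
  opD n m (tsum s F) = tsum s (fun w => opD n m (F w)).
Proof. by move=> nN mN; rewrite /opD !tsum_GG ?tsumB //; lia. Qed.

Lemma tsum_opE k i n m F : N <= k -> N <= i -> N <= n -> N <= m ->
  opE k i n m (tsum s F) = tsum s (fun w => opE k i n m (F w)).
Proof.
by move=> kN iN nN mN; rewrite /opE !tsum_opD ?tsum_GG ?tsumB //; lia.
Qed.

(** The bound on [T] is [N <= T - 3 * N - 4]: all modes occurring in P have index at least [N]. *)
Lemma tsum_opP r T F : 0 <= N -> 4 * N + 4 <= T ->
  opP r N T (tsum s F) = tsum s (fun w => opP r N T (F w)).
Proof.
move=> N0 NT; rewrite /opP tsum_opD ?tsum_opE; try lia.
by rewrite [RHS]tsumB tsumZ.
Qed.

End Nilfrom.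

Fact tens_L0r_l (w : A) : linear (fun v : V => tens v (nsgact (genL 0) w) : tensor V A).
Proof. exact: tens_linearl. Qed.
Fact tens_L0r_r (v : V) : linear (fun w : A => tens v (nsgact (genL 0) w) : tensor V A).
Proof. by move=> a x y; rewrite linearP tens_linearr. Qed.
Fact tens_L0l_l (w : A) : linear (fun v : V => tens (nsgact (genL 0) v) w : tensor V A).
Proof. by move=> a x y; rewrite linearP tens_linearl. Qed.
Fact tens_L0l_r (v : V) : linear (fun w : A => tens (nsgact (genL 0) v) w : tensor V A).
Proof. exact: tens_linearr. Qed.

Definition L0r : {linear tensor_mod V A -> tensor_mod V A} := tlift tens_L0r_l tens_L0r_r.
Definition L0l : {linear tensor_mod V A -> tensor_mod V A} := tlift tens_L0l_l tens_L0l_r.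

Lemma L0rE v w : L0r (tens v w) = tens v (nsgact (genL 0) w).
Proof. exact: tliftE. Qed.

Lemma L0lE v w : L0l (tens v w) = tens (nsgact (genL 0) v) w.
Proof. exact: tliftE. Qed.

Lemma L0_split (z : tensor_mod V A) : nsgact (genL 0) z = L0l z + L0r z.
Proof.
move: z; apply: tensor_ind.
  apply: eq_lin_closed => k x y; first exact: linearP.
  by rewrite !linearP scalerDr addrACA.
by move=> v w; rewrite L0rE L0lE [LHS]tens_actE.
Qed.

Lemma L0l_annihilated (L : K -> Prop) :
  (forall v : V, annihilated (@nsgact K V (genL 0)) L v) ->
  forall z : tensor_mod V A, annihilated L0l L z.
Proof.
move=> annV; apply: tensor_ind => [|v w]; first exact: annihilated_lin.
have [s sL sv] := annV v; exists s => //.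
have -> : forall v, shifts L0l s (tens v w) = tens (shifts (@nsgact K V (genL 0)) s v) w.
  by elim: s {sL sv} => //= l s IH x; rewrite IH L0lE tensBZl.
by rewrite sv tens0l.
Qed.

Lemma tsum_L0r s F : L0r (tsum s F) = tsum s (fun w => nsgact (genL 0) (F w)).
Proof. by rewrite /tsum linear_sum; apply: eq_bigr => p _; exact: L0rE. Qed.

End TensorSums.

(** * Invariants of the isomorphism class *)

Section IsoInvariants.
Variables (K : numFieldType) (c h a b c1 h1 a1 b1 : K) (V V1 A A1 : nsmod K).
Variables (u : V) (u1 : V1) (X Y : int -> A) (X1 Y1 : int -> A1).
Hypotheses (hV : hwmod c h u) (hV1 : hwmod c1 h1 u1).
Hypotheses (hA : samod a b X Y) (hA1 : samod a1 b1 X1 Y1).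
Hypotheses (b_neq1 : b != 1) (b1_neq1 : b1 != 1).
Variable f : {linear tensor_mod V A -> tensor_mod V1 A1}.
Hypothesis f_inj : injective f.
Hypothesis fact : forall g x, f (nsgact g x) = nsgact g (f x).

Local Notation al := (2 * (b - 1)).
Local Notation al1 := (2 * (b1 - 1)).

Let m j : tensor_mod V A := tens u (X j).
Let z j := f (m j).

Let mE j : m j = tsum [:: (u, X j)] id.
Proof. by rewrite /tsum big_seq1. Qed.

Let m_nil j : nilfrom 1 [:: (u, X j)].
Proof.
move=> p; rewrite inE => /eqP-> n n1; split; [apply: (hw_posL hV)|apply: (hw_posG hV)]; lia.
Qed.

(** Contracting the second factor with [xi] sends [m j] to a nonzero multiple of [u]. *)
Lemma tens_top_neq0 j : m j <> 0.
Proof.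
have [xi xij] := sam_coef hA j => mj0; apply: (hw_neq0 hV).
have fl (w : A) : linear (fun v : V => xi w *: v) by move=> r x y; rewrite scalerDr !scalerA mulrC.
have fr (v : V) : linear (fun w : A => xi w *: v).
  by move=> r x y; rewrite linearP scalerDl scalerA.
have := linear0 (tlift fl fr); rewrite -mj0 /m tliftE => /eqP.
by rewrite scaler_eq0 => /orP[/eqP|/eqP].
Qed.

Let z_neq0 j : z j != 0.
Proof. by apply/eqP => z0; apply: (@tens_top_neq0 j); apply: f_inj; rewrite linear0. Qed.

Let z_L p j : 0 < p -> nsgact (genL p) (z j) = (a + j%:~R + p%:~R * b) *: z (p + j).
Proof.
move=> p0; rewrite /z -fact mE (tsum_L (@m_nil j)); last by lia.
by rewrite /tsum big_seq1 (sam_Lx hA) tensZr linearZ.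
Qed.

Let z_L0 j : nsgact (genL 0) (z j) = (h + (a + j%:~R)) *: z j.
Proof.
rewrite /z -fact L0_split L0rE L0lE (hw_L0 hV) (sam_Lx hA) mul0r addr0 add0r tensZl tensZr.
by rewrite -scalerDl linearZ.
Qed.

Let z_D n k j : 1 <= n -> 1 <= k -> opD n k (z j) = al *: z (n + k + 2 + j).
Proof.
move=> n1 k1; rewrite /z -(opD_morph fact) mE (tsum_opD (@m_nil j)) //.
by rewrite /tsum big_seq1 (opD_X hA) tensZr linearZ.
Qed.

Let z_E l i n k j : 1 <= l -> 1 <= i -> 1 <= n -> 1 <= k -> opE l i n k (z j) = 0.
Proof.
move=> l1 i1 n1 k1; rewrite /z -(opE_morph fact) mE (tsum_opE (@m_nil j)) //.
by rewrite /tsum big_seq1 (opE_X hA) tens0r linear0.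
Qed.

Let z_nilfrom j : exists N s, [/\ 1 <= N, nilfrom N s & z j = tsum s id].
Proof.
have [s zs] := tsum_exists (z j).
have [N N1 Ns] := nilfrom_exists s (hw_nilp hV1).
by exists N, s.
Qed.

(* [opP] projects onto the first summand of [A1] up to a shift; on [z j] it
   acts through [A1] only, but also as a multiple of a shift of [j]. *)
Let z_P N s j T : 1 <= N -> nilfrom N s -> z j = tsum s id -> 4 * N + 4 <= T ->
  (al1 * al) *: z (T + j) = tsum s (opP al1 N T).
Proof.
move=> N1 Ns zs NT; transitivity (opP al1 N T (z j)); last first.
  by rewrite zs (tsum_opP Ns) //; lia.
rewrite /opP z_E; try lia; rewrite z_D; try lia.
by rewrite subr0 scalerA; congr (_ *: z _); ring.
Qed.

Let al_neq0 : al != 0.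
Proof. by rewrite mulf_neq0 ?subr_eq0 // pnatr_eq0. Qed.

Let al1_neq0 : al1 != 0.
Proof. by rewrite mulf_neq0 ?subr_eq0 // pnatr_eq0. Qed.

(** D applied to a P-image of [z 0] is [al] times a shift seen from the source and [al1] times the
    same shift seen from the target. *)
Lemma iso_b : b = b1.
Proof.
have [N [s [N1 Ns zs]]] := z_nilfrom 0.
pose T := 4 * N + 4.
have eP : opD N N ((al1 * al) *: z (T + 0)) = al1 *: ((al1 * al) *: z (N + N + 2 + T + 0)).
  rewrite (z_P N1 Ns zs (lexx _)) (z_P N1 Ns zs); last by rewrite /T; lia.
  rewrite (tsum_opD Ns) // -tsumZ; apply: eq_tsum => w; exact: (opD_opP hA1).
have : al = al1.
  move: eP; rewrite opDZ z_D // addrA [LHS]scalerA [in RHS]scalerA => /eqP.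
  rewrite -subr_eq0 -scalerBl scaler_eq0 (negbTE (z_neq0 _)) orbF.
  have -> : al1 * al * al - al1 * (al1 * al) = al1 * al * (al - al1) by ring.
  rewrite mulf_eq0 (negbTE (mulf_neq0 al1_neq0 al_neq0)) subr_eq0.
  by move/eqP.
by move/(mulfI (_ : 2 != 0)); rewrite pnatr_eq0 => /(_ isT)/addIr.
Qed.

Lemma iso_top : exists J, [/\ L0r V1 A1 (z J) = (a + J%:~R) *: z J
  & annihilated (L0r V1 A1) (fun l => exists i : int, l = a1 + i%:~R) (z J)].
Proof.
have [N [s [N1 Ns zs]]] := z_nilfrom 0.
(* [T] is the least degree allowed in [z_P]; L_N then leads from the P-image of degree [T] to that
   of degree [N + T]. *)
pose T := 4 * N + 4; pose J := N + T + 0.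
have aa0 : al1 * al != 0 by rewrite mulf_neq0.
have TJ : 4 * N + 4 <= N + T by rewrite /T; lia.
have zJ := z_P N1 Ns zs TJ; rewrite -/J in zJ.
exists J; split.
  apply: (scalerI aa0); rewrite -[LHS]linearZ zJ tsum_L0r.
  have : nsgact (genL N) ((al1 * al) *: z (T + 0)) =
      L0r V1 A1 (tsum s (opP al1 N (N + T))) + (N%:~R * (b1 - 1)) *: tsum s (opP al1 N (N + T)).
    rewrite (z_P N1 Ns zs (lexx _)) (tsum_L Ns) // tsum_L0r -tsumZ -tsumD.
    by apply: eq_tsum => w; exact: (L_opP hA1).
  (* The source gives the coefficient [a + T + N * b]; subtracting [N * (b1 - 1)] with [b = b1]
     leaves [a + J]. *)
  rewrite linearZ /= z_L; last by lia.
  rewrite tsum_L0r addrA -/J -zJ => /eqP; rewrite -subr_eq => /eqP <-.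
  rewrite !scalerA -scalerBl; congr (_ *: _).
  by rewrite /J iso_b !intrD; ring.
(* Up to a scalar, [z J] is a sum of tensors whose second components lie in the span of the [X1 i],
   where L_0 has eigenvalues in [a1] plus integers. *)
rewrite -[z J](scalerK aa0) zJ; apply: lin_closedZ; first exact: annihilated_lin.
apply: lin_closed_sum => [|p]; first exact: annihilated_lin.
move: p.2; apply: (sam_ind hA1) => [|i|i].
- pose G w : tensor_mod V1 A1 := tens p.1 (opP al1 N (N + T) w).
  have Gl : linear G by move=> r x y; rewrite /G opP_linear tens_linearr.
  pose G' : {linear A1 -> tensor_mod V1 A1} := HB.pack G (GRing.isLinear.Build K _ _ *:%R G Gl).
  exact: (lin_closed_pre G' (annihilated_lin _ _)).
- rewrite (opP_X hA1) tensZr; apply: lin_closedZ; first exact: annihilated_lin.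
  apply: (annihilated_eigen (l := a1 + (N + T + i)%:~R)); first by exists (N + T + i).
  by rewrite L0rE (sam_Lx hA1) mul0r addr0 add0r tensZr.
- rewrite (opP_Y hA1) tens0r; exact: (annihilated_lin _ _).1.
Qed.

Lemma iso_a : exists i : int, a = a1 + i%:~R.
Proof.
have [J [eJ aJ]] := iso_top.
have [i e] := eigen_annihilated eJ (elimN eqP (z_neq0 J)) aJ.
by exists (i - J); rewrite intrB addrA -e addrK.
Qed.

(** Subtracting [L0r] from L_0 shows that [z J] has eigenvalue [h] for [L0l], whose eigenvalues are
    weights of [V1]. *)
Lemma iso_h : exists n : nat, h = h1 - n%:R / 2.
Proof.
have [J [eJ _]] := iso_top.
have eh : L0l V1 A1 (z J) = h *: z J.
  by apply/(addIr (L0r V1 A1 (z J))); rewrite -L0_split z_L0 eJ -scalerDl.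
apply: (eigen_annihilated (L := fun l => exists n : nat, l = h1 - n%:R / 2) eh).
  exact: (elimN eqP (z_neq0 J)).
by apply: L0l_annihilated => v; exact: (hw_weights hV1).
Qed.

Lemma iso_c : c = c1.
Proof.
have tC (U B : nsmod K) k x (v : U) (w : B) : 
    nsgact genC v = k *: v -> nsgact genC w = 0 -> x = tens v w :> tensor_mod U B ->
    nsgact genC x = k *: x.
  move=> Cv Cw ->; rewrite [LHS]tens_actE Cv Cw tens0r addr0.
  exact: tensZl.
have Cz x : nsgact genC x = c1 *: x :> tensor_mod V1 A1.
  move: x; apply: tensor_ind => [|v w].
    apply: eq_lin_closed => [r x y|r x y]; first exact: linearP.
    by rewrite scalerDr !scalerA mulrC.
  by apply: tC (erefl _); [exact: hw_C hV1 _|exact: sam_C hA1 _].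
have : c *: z 0 = c1 *: z 0.
  rewrite -Cz /z -fact; rewrite (tC _ _ c (m 0) _ _ _ _ (erefl _)) ?linearZ //.
    exact: hw_C hV _.
  exact: sam_C hA _.
move/eqP; rewrite -subr_eq0 -scalerBl scaler_eq0 (negbTE (z_neq0 0)) orbF subr_eq0.
by move/eqP.
Qed.

End IsoInvariants.

(** * From the invariants to the classification *)

Lemma nsiso_sym (K : numFieldType) (M M1 : nsmod K) : nsiso M M1 -> nsiso M1 M.
Proof.
move=> [f [[g fK gK] fact]].
have gl : linear g by move=> k x y; apply: (can_inj fK); rewrite linearP !gK.
pose g' : {linear M1 -> M} := HB.pack g (GRing.isLinear.Build K M1 M *:%R g gl).
exists g'; split; first by exists f.
by move=> x v; apply: (can_inj fK); rewrite fact /= !gK.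
Qed.

Lemma nsiso_invariants (K : numFieldType) (c h a b c1 h1 a1 b1 : K)
    (Q : simple_quotient (verma c h)) (Q1 : simple_quotient (verma c1 h1)) :
  b != 1 -> b1 != 1 ->
  nsiso (tensor_mod (sq_mod Q) (SA' a b)) (tensor_mod (sq_mod Q1) (SA' a1 b1)) ->
  [/\ c = c1, b = b1, exists i : int, a = a1 + i%:~R & exists n : nat, h = h1 - n%:R / 2].
Proof.
move=> b1n b1n1 [f [[g fK gK] fact]].
have [X [Y hA]] := SA'_samod a b; have [X1 [Y1 hA1]] := SA'_samod a1 b1.
have hQ := sq_hwmod Q; have hQ1 := sq_hwmod Q1.
have fgen e v : f (nsgact e v) = nsgact e (f v) by rewrite -!nsact_nsb fact.
have f_inj := can_inj fK.
split.
- exact: (iso_c hQ hQ1 hA hA1 f_inj fgen).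
- exact: (iso_b hQ hQ1 hA hA1 b1n b1n1 f_inj fgen).
- exact: (iso_a hQ hQ1 hA hA1 b1n b1n1 f_inj fgen).
- exact: (iso_h hQ hQ1 hA hA1 b1n b1n1 f_inj fgen).
Qed.

Theorem theorem4p1 (R : realType) (c h a b c1 h1 a1 b1 : R[i])
    (V : simple_quotient (verma c h)) (V1 : simple_quotient (verma c1 h1))
    (ha : 0 <= complex.Re a < 1) (ha1 : 0 <= complex.Re a1 < 1)
    (hb : b <> 1) (hb1 : b1 <> 1) :
  nsiso (tensor_mod (sq_mod V) (SA' a b)) (tensor_mod (sq_mod V1) (SA' a1 b1)) <->
  c = c1 /\ h = h1 /\ a = a1 /\ b = b1.
Proof.
split=> [iso|]; last first.
  move=> [cc [hh [aa bb]]]; subst c1 h1 a1 b1; exact: sq_nsiso.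
move/eqP: hb => hb; move/eqP: hb1 => hb1.
have [cc bb [i ai] [n hn]] := nsiso_invariants hb hb1 iso.
(* The inverse isomorphism bounds the difference of weights from the other side, so [n + k = 0]. *)
have [_ _ _ [k hk]] := nsiso_invariants hb1 hb (nsiso_sym iso).
split=> //; split.
  have /eqP : ((n + k)%:R / 2 : R[i]) = 0.
    by rewrite natrD mulrDl -[n%:R / 2](subKr h1) -hn -[k%:R / 2](subKr h) -hk; ring.
  rewrite mulf_eq0 invr_eq0 !pnatr_eq0 orbF addn_eq0 => /andP[/eqP n0 _].
  by rewrite hn n0 mul0r subr0.
split=> //.
have Rai : complex.Re a = complex.Re a1 + i%:~R.
  by rewrite ai raddfD -(rmorph_int (real_complex R)).
(* Both real parts lie in an interval of length one, open at its right end, so the integer [i] lies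
   strictly between -1 and 1. *)
suff i0 : i = 0 by rewrite ai i0 addr0.
move: ha ha1; rewrite Rai => /andP[i1 i2] /andP[i3 i4].
have : (-1 < i%:~R :> R) by lra.
have : (i%:~R < 1 :> R) by lra.
rewrite -[1]/(1%:~R) -mulrNz !ltr_int; lia.
Qed.
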